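(* Let $\kappa:\mathbb{D}\setminus\{0\}\to\mathbb{R}$ be strictly negative at $z=0$ and let $u:\mathbb{D}\setminus\{0\}\to\mathbb{R}$ be a $C^2$-solution to $\Delta u=-\kappa(z)\,e^{2u}$ in $\mathbb{D}\setminus\{0\}$. Then $\alpha\le1$, where $\alpha$ is the order of $u$, i.e. $$\alpha:=\lim_{r\to0}\frac{M_u(r)}{\log(1/r)},$$ and $$u(z)=-\alpha\log|z|+v(z)\quad\text{if }\alpha<1,\qquad u(z)=-\log|z|-\log\log(1/|z|)+w(z)\quad\text{if }\alpha=1,$$ where $v(z)$ is continuous at $z=0$ and $w(z)=O(1)$ as $z\to0$.
   Context: $\mathbb{D}=\{z\in\mathbb{C}:|z|<1\}$, $\Delta=\partial_x^2+\partial_y^2$ for $z=x+iy$, and $M_u(r):=\sup_{|z|=r}u(z)$. A function $\kappa:\mathbb{D}\setminus\{0\}\to\mathbb{R}$ is called strictly negative at $z=0$ if there are finite constants $a>0$, $A>0$ with $-a\le\kappa(z)\le-A$ for all $z$ in some punctured neighborhood of $z=0$. Under these hypotheses the limit defining $\alpha$ always exists and is $>-\infty$, since $u$ is subharmonic in a punctured neighborhood of $0$. The functions $v$, $w$ are defined on $\mathbb{D}\setminus\{0\}$ by the displayed formulas; ''$v$ is continuous at $z=0$'' means that $v$ extends continuously to $z=0$ (with a finite value). *)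

(* Defs.v *)
From Stdlib Require Import Reals.
From Coquelicot Require Import Coquelicot.
Open Scope R_scope.

(* Functions on the punctured disk are represented by total functions C -> R;
   only their values on [punctured_disk] are ever constrained.
   [C] is Coquelicot's [R * R], so (x, y) is the point x + iy. *)
Definition punctured_disk (z : C) : Prop := z <> RtoC 0 /\ Cmod z < 1.

Definition ex_dx (f : C -> R) (z : C) : Prop :=
  ex_derive (fun t : R => f (t, Im z)) (Re z).
Definition ex_dy (f : C -> R) (z : C) : Prop :=
  ex_derive (fun t : R => f (Re z, t)) (Im z).

Definition dx (f : C -> R) (z : C) : R :=
  Derive (fun t : R => f (t, Im z)) (Re z).
Definition dy (f : C -> R) (z : C) : R :=
  Derive (fun t : R => f (Re z, t)) (Im z).

(* Meant for open U; [continuous] is joint continuity at a point of the plane. *)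
Definition C1_on (U : C -> Prop) (f : C -> R) : Prop :=
  forall z : C, U z ->
    continuous f z /\
    ex_dx f z /\ ex_dy f z /\
    continuous (dx f) z /\ continuous (dy f) z.

Definition C2_on (U : C -> Prop) (f : C -> R) : Prop :=
  C1_on U f /\ C1_on U (dx f) /\ C1_on U (dy f).

Definition laplacian (f : C -> R) (z : C) : R := dx (dx f) z + dy (dy f) z.

Definition strictly_negative_at_0 (kappa : C -> R) : Prop :=
  exists a A : R, 0 < a /\ 0 < A /\
    locally' (RtoC 0) (fun z : C => - a <= kappa z <= - A).

(* The supremum is taken in [Rbar] and projected to R; it is finite whenever u
   is continuous on the (compact) circle |z| = r, r > 0. *)
Definition circle_sup (u : C -> R) (r : R) : R :=
  real (Lub_Rbar (fun y : R => exists z : C, Cmod z = r /\ y = u z)).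

Definition is_order (u : C -> R) (alpha : R) : Prop :=
  filterlim (fun r : R => circle_sup u r / ln (1 / r))
    (at_right 0) (locally alpha).

Definition bounded_near_0 (w : C -> R) : Prop :=
  exists M : R, locally' (RtoC 0) (fun z : C => Rabs (w z) <= M).

(* Main.v *)
Require Import Defs.
From Stdlib Require Import Reals Lra Psatz Classical ClassicalEpsilon.
From Coquelicot Require Import Coquelicot.
Open Scope R_scope.

(** Everything follows from the maximum principle, applied to explicit barriers that
    are functions of [tau z = - ln |z|] (for which the Laplacian is the second
    derivative divided by [|z|^2]) or polynomials.

    Near 0 one has [A e^(2u) <= Laplacian u <= a e^(2u)]. The left inequality allows a
    comparison with supersolutions that blow up at the boundary of annuli and gives,
    as in Ahlfors' lemma, [u <= tau - ln tau + O(1)] ([ahlfors_bound]). As [u] is subharmonic, its maximum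
    [m t] on the circle [tau = t] is convex in [t] ([circle_max_convex]); hence
    [m t / t] has a limit [alpha], the increments [m (t + 1) - m t] tend to [alpha], and
    the upper bound forces [alpha <= 1] ([convex_slope]).

    The main point is to pass from circle maxima to [u] itself, that is
    [m (tau z) - u z -> 0] ([oscillation_vanishes]). On a circle [tau = t], an affine
    function of [tau] minus [u] is nonnegative, almost 0 at the maximum point of [u],
    and almost harmonic because [|z|^2 e^(2u) -> 0]; Harnack's inequality makes it small
    on the whole circle. Harnack's inequality itself is obtained without Poisson
    integrals ([harnack_unit]): near a point where a weighted positive function is
    maximal, the function is bounded by a multiple of its value [N] there, so a reflection
    argument ([bisector_estimate]) keeps it above [N / 2] on a small disc, and a
    logarithmic barrier ([log_barrier]) propagates this to the centre.

    It follows that [u = alpha tau + o(tau)]. This growth is what the maximum principle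
    on a punctured disc tolerates ([max_principle_puncture]), so [u] can be bounded from
    below by subsolutions: by [alpha tau + O(1)] if [alpha < 1], by
    [tau - ln tau + O(1)] if [alpha = 1]. In the first case [m t - alpha t] is monotone
    and now bounded, so it converges, and [u - alpha tau] has the same limit. *)

(** * Second order expansions and the Laplacian *)

Definition jet1 (phi : R -> R) (t p a : R) : Prop :=
  forall eps : R, 0 < eps -> exists d : R, 0 < d /\
  forall h : R, Rabs h < d ->
    Rabs (phi (t + h) - (phi t + p * h + a * (h * h) / 2)) <= eps * (h * h).

Definition jet (f : C -> R) (z : C) (p q a b c : R) : Prop :=
  forall eps : R, 0 < eps -> exists d : R, 0 < d /\
  forall h k : R, Rabs h < d -> Rabs k < d ->
    Rabs (f (Re z + h, Im z + k) -
          (f z + p * h + q * k + (a * (h * h) + 2 * b * (h * k) + c * (k * k)) / 2))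
      <= eps * (h * h + k * k).

(** The Laplacian read off a second order expansion. Unlike the one defined by
    iterated partial derivatives it involves no derivative at other points, passes
    through plane isometries by pure algebra, and obeys a chain rule, so that it
    serves both for the solution and for every barrier. *)
Definition has_lap (f : C -> R) (z : C) (L : R) : Prop :=
  exists p q a b c : R, jet f z p q a b c /\ a + c = L.

Lemma C_eta (z : C) : (Re z, Im z) = z.
Proof. now destruct z. Qed.

Lemma jet_ext f g z p q a b c :
  (forall w, f w = g w) -> jet f z p q a b c -> jet g z p q a b c.
Proof.
  intros E H eps He. destruct (H eps He) as [d [Hd H']].
  exists d; split; [exact Hd|]. intros h k h1 k1. rewrite <- !E. now apply H'.
Qed.

Lemma jet_plus f g z p q a b c p' q' a' b' c' :
  jet f z p q a b c -> jet g z p' q' a' b' c' ->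
  jet (fun w => f w + g w) z (p + p') (q + q') (a + a') (b + b') (c + c').
Proof.
  intros Hf Hg eps He.
  destruct (Hf (eps / 2)) as [d1 [Hd1 H1]]; [lra|].
  destruct (Hg (eps / 2)) as [d2 [Hd2 H2]]; [lra|].
  exists (Rmin d1 d2); split; [now apply Rmin_pos|].
  intros h k Hh Hk.
  pose proof (Rmin_l d1 d2); pose proof (Rmin_r d1 d2).
  specialize (H1 h k ltac:(lra) ltac:(lra)).
  specialize (H2 h k ltac:(lra) ltac:(lra)).
  apply Rabs_le_between in H1. apply Rabs_le_between in H2.
  apply Rabs_le_between. lra.
Qed.

Lemma jet_scal l f z p q a b c :
  jet f z p q a b c ->
  jet (fun w => l * f w) z (l * p) (l * q) (l * a) (l * b) (l * c).
Proof.
  intros Hf eps He.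
  assert (Hl : 0 < Rabs l + 1) by (pose proof (Rabs_pos l); lra).
  destruct (Hf (eps / (Rabs l + 1))) as [d [Hd H]]; [now apply Rdiv_lt_0_compat|].
  exists d; split; [exact Hd|]. intros h k Hh Hk.
  specialize (H h k Hh Hk).
  match type of H with Rabs ?e <= _ => set (E := e) in * end.
  replace (_ - _) with (l * E) by (unfold E; field).
  rewrite Rabs_mult.
  assert (0 <= h * h + k * k) by nra.
  apply Rle_trans with ((Rabs l + 1) * (eps / (Rabs l + 1) * (h * h + k * k))).
  - apply Rmult_le_compat; try apply Rabs_pos; try lra.
  - right. field. lra.
Qed.

Lemma jet_const l z : jet (fun _ => l) z 0 0 0 0 0.
Proof.
  intros eps He. exists 1; split; [lra|]. intros h k _ _.
  replace (_ - _) with 0 by field. rewrite Rabs_R0. nra.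
Qed.

Lemma has_lap_ext f g z L : (forall w, f w = g w) -> has_lap f z L -> has_lap g z L.
Proof.
  intros E (p & q & a & b & c & H & HL). exists p, q, a, b, c. split; [|exact HL].
  now apply (jet_ext f).
Qed.

Lemma has_lap_plus f g z L M :
  has_lap f z L -> has_lap g z M -> has_lap (fun w => f w + g w) z (L + M).
Proof.
  intros (p & q & a & b & c & H & HL) (p' & q' & a' & b' & c' & H' & HL').
  exists (p + p'), (q + q'), (a + a'), (b + b'), (c + c'). split; [|lra].
  now apply jet_plus.
Qed.

Lemma has_lap_scal l f z L : has_lap f z L -> has_lap (fun w => l * f w) z (l * L).
Proof.
  intros (p & q & a & b & c & H & HL).
  exists (l * p), (l * q), (l * a), (l * b), (l * c). split; [|rewrite <- HL; ring].
  now apply jet_scal.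
Qed.

Lemma has_lap_const l z : has_lap (fun _ => l) z 0.
Proof. exists 0, 0, 0, 0, 0. split; [apply jet_const|lra]. Qed.

Lemma has_lap_minus f g z L M :
  has_lap f z L -> has_lap g z M -> has_lap (fun w => f w - g w) z (L - M).
Proof.
  intros Hf Hg. replace (L - M) with (L + (-1) * M) by ring.
  apply has_lap_ext with (fun w => f w + (-1) * g w); [intros; ring|].
  apply has_lap_plus; [exact Hf|]. now apply has_lap_scal.
Qed.

(** With [D] the increment of [f] and [lin] its linear part, the only error term that
    does not come from the two expansions is [s2 / 2 * (D - lin) * (D + lin)], which
    is cubic in [r = sqrt (h^2 + k^2)]. *)
Lemma jet_comp phi f z p q a b c s1 s2 :
  jet f z p q a b c -> jet1 phi (f z) s1 s2 ->
  jet (fun w => phi (f w)) z (s1 * p) (s1 * q)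
    (s2 * (p * p) + s1 * a) (s2 * (p * q) + s1 * b) (s2 * (q * q) + s1 * c).
Proof.
  intros Hf Hp eps He.
  set (P := Rabs p + Rabs q).
  set (Q := (Rabs a + 2 * Rabs b + Rabs c) / 2).
  set (K := P + Q + 1).
  assert (HP : 0 <= P) by (unfold P; pose proof (Rabs_pos p); pose proof (Rabs_pos q); lra).
  assert (HQ : 0 <= Q)
    by (unfold Q; pose proof (Rabs_pos a); pose proof (Rabs_pos b); pose proof (Rabs_pos c); lra).
  assert (HK : 1 <= K) by (unfold K; lra).
  assert (Hs1 : 0 < Rabs s1 + 1) by (pose proof (Rabs_pos s1); lra).
  assert (Hs2 : 0 < Rabs s2 + 1) by (pose proof (Rabs_pos s2); lra).
  set (e1 := Rmin 1 (eps / (3 * (Rabs s1 + 1)))).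
  assert (He1 : 0 < e1) by (apply Rmin_pos; [lra|apply Rdiv_lt_0_compat; lra]).
  assert (He1' : e1 <= 1) by apply Rmin_l.
  assert (He1'' : e1 * (3 * (Rabs s1 + 1)) <= eps).
  { apply Rle_trans with (eps / (3 * (Rabs s1 + 1)) * (3 * (Rabs s1 + 1))).
    - apply Rmult_le_compat_r; [lra|]. apply Rmin_r.
    - right. field. lra. }
  set (e2 := eps / (3 * (K * K))).
  assert (HKK : 0 < K * K) by nra.
  assert (He2 : 0 < e2) by (apply Rdiv_lt_0_compat; lra).
  destruct (Hf e1 He1) as [d1 [Hd1 H1]].
  destruct (Hp e2 He2) as [d2 [Hd2 H2]].
  set (W := 3 * ((Rabs s2 + 1) * ((Q + 1) * K))).
  assert (HW : 0 < W) by (unfold W; repeat apply Rmult_lt_0_compat; lra).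
  set (r0 := Rmin 1 (Rmin (d2 / K) (eps / W))).
  assert (Hr0 : 0 < r0).
  { repeat apply Rmin_pos; try lra; apply Rdiv_lt_0_compat; lra. }
  exists (Rmin d1 (r0 / 2)); split; [apply Rmin_pos; lra|].
  intros h k Hh Hk.
  pose proof (Rmin_l d1 (r0 / 2)); pose proof (Rmin_r d1 (r0 / 2)).
  specialize (H1 h k ltac:(lra) ltac:(lra)).
  set (n2 := h * h + k * k) in *.
  set (r := sqrt n2).
  assert (Hn2 : 0 <= n2) by (unfold n2; nra).
  assert (Hrr : r * r = n2) by (now apply sqrt_sqrt).
  assert (Hr : 0 <= r) by apply sqrt_pos.
  assert (Hhr : Rabs h <= r).
  { apply Rsqr_incr_0; [|apply Rabs_pos|exact Hr]. rewrite <- Rsqr_abs. unfold Rsqr, n2 in *. nra. }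
  assert (Hkr : Rabs k <= r).
  { apply Rsqr_incr_0; [|apply Rabs_pos|exact Hr]. rewrite <- Rsqr_abs. unfold Rsqr, n2 in *. nra. }
  assert (Hr1 : r < r0).
  { apply Rsqr_incrst_0; [|exact Hr|lra]. unfold Rsqr. rewrite Hrr. unfold n2.
    assert (A1 : h * h = Rabs h * Rabs h) by (rewrite <- Rabs_mult; symmetry; apply Rabs_pos_eq; nra).
    assert (A2 : k * k = Rabs k * Rabs k) by (rewrite <- Rabs_mult; symmetry; apply Rabs_pos_eq; nra).
    rewrite A1, A2. pose proof (Rabs_pos h); pose proof (Rabs_pos k). nra. }
  assert (Hrle1 : r <= 1) by (pose proof (Rmin_l 1 (Rmin (d2 / K) (eps / W))); unfold r0 in Hr1; lra).
  assert (HrK : K * r < d2).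
  { assert (r < d2 / K).
    { eapply Rlt_le_trans; [exact Hr1|]. unfold r0.
      eapply Rle_trans; [apply Rmin_r|apply Rmin_l]. }
    replace d2 with (K * (d2 / K)) by (field; lra).
    apply Rmult_lt_compat_l; lra. }
  assert (HrW : W * r <= eps).
  { assert (r < eps / W).
    { eapply Rlt_le_trans; [exact Hr1|]. unfold r0.
      eapply Rle_trans; [apply Rmin_r|apply Rmin_r]. }
    replace eps with (W * (eps / W)) by (field; lra).
    apply Rmult_le_compat_l; lra. }
  set (lin := p * h + q * k).
  set (quad := (a * (h * h) + 2 * b * (h * k) + c * (k * k)) / 2).
  set (D := f (Re z + h, Im z + k) - f z).
  assert (Hlin : Rabs lin <= P * r).
  { unfold lin, P. eapply Rle_trans; [apply Rabs_triang|]. rewrite !Rabs_mult.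
    pose proof (Rabs_pos p); pose proof (Rabs_pos q). nra. }
  assert (Hquad : Rabs quad <= Q * n2).
  { unfold quad, Q. unfold Rdiv. rewrite Rabs_mult. rewrite (Rabs_pos_eq (/ 2)) by lra.
    assert (Rabs (a * (h * h) + 2 * b * (h * k) + c * (k * k))
            <= (Rabs a + 2 * Rabs b + Rabs c) * n2); [|nra].
    eapply Rle_trans; [apply Rabs_triang|].
    eapply Rle_trans; [apply Rplus_le_compat_r, Rabs_triang|].
    rewrite !Rabs_mult. rewrite (Rabs_pos_eq 2) by lra.
    pose proof (Rabs_pos a); pose proof (Rabs_pos b); pose proof (Rabs_pos c).
    pose proof (Rabs_pos h); pose proof (Rabs_pos k).
    rewrite <- Hrr.
    assert (Rabs h * Rabs h <= r * r) by nra.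
    assert (Rabs k * Rabs k <= r * r) by nra.
    assert (Rabs h * Rabs k <= r * r) by nra.
    nra. }
  assert (HE1 : Rabs (D - lin - quad) <= e1 * n2).
  { replace (D - lin - quad) with
      (f (Re z + h, Im z + k) -
       (f z + p * h + q * k + (a * (h * h) + 2 * b * (h * k) + c * (k * k)) / 2))
      by (unfold D, lin, quad; ring). exact H1. }
  assert (HDl : Rabs (D - lin) <= (Q + 1) * n2).
  { replace (D - lin) with ((D - lin - quad) + quad) by ring.
    eapply Rle_trans; [apply Rabs_triang|]. nra. }
  assert (Hn2r : n2 <= r) by (rewrite <- Hrr; nra).
  assert (HD : Rabs D <= K * r).
  { replace D with ((D - lin) + lin) by ring.
    eapply Rle_trans; [apply Rabs_triang|]. unfold K. nra. }
  assert (HDpl : Rabs (D + lin) <= 2 * K * r).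
  { eapply Rle_trans; [apply Rabs_triang|]. unfold K in *. nra. }
  specialize (H2 D ltac:(lra)).
  replace (f (Re z + h, Im z + k)) with (f z + D) by (unfold D; ring).
  set (E2 := phi (f z + D) - (phi (f z) + s1 * D + s2 * (D * D) / 2)) in *.
  replace (_ - _) with (s1 * (D - lin - quad) + (s2 / 2) * ((D - lin) * (D + lin)) + E2)
    by (unfold E2, lin, quad; field).
  assert (T1 : Rabs (s1 * (D - lin - quad)) <= eps / 3 * n2).
  { rewrite Rabs_mult. pose proof (Rabs_pos s1).
    apply Rle_trans with (Rabs s1 * (e1 * n2)); [now apply Rmult_le_compat_l|].
    rewrite <- Rmult_assoc. apply Rmult_le_compat_r; [exact Hn2|]. nra. }
  assert (T2 : Rabs ((s2 / 2) * ((D - lin) * (D + lin))) <= eps / 3 * n2).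
  { unfold Rdiv at 1. rewrite !Rabs_mult. rewrite (Rabs_pos_eq (/ 2)) by lra.
    pose proof (Rabs_pos s2).
    assert (Rabs (D - lin) * Rabs (D + lin) <= ((Q + 1) * n2) * (2 * K * r))
      by (apply Rmult_le_compat; auto using Rabs_pos).
    apply Rle_trans with (Rabs s2 * / 2 * (((Q + 1) * n2) * (2 * K * r))).
    { apply Rmult_le_compat_l; [nra|assumption]. }
    replace (Rabs s2 * / 2 * ((Q + 1) * n2 * (2 * K * r)))
      with ((Rabs s2 * ((Q + 1) * K) * r) * n2) by field.
    apply Rmult_le_compat_r; [exact Hn2|].
    apply Rle_trans with (W * r / 3); [|lra].
    unfold W. assert (0 <= (Q + 1) * K * r) by (repeat apply Rmult_le_pos; lra). nra. }
  assert (T3 : Rabs E2 <= eps / 3 * n2).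
  { eapply Rle_trans; [exact H2|].
    assert (D * D <= K * K * n2).
    { rewrite <- Hrr. replace (D * D) with (Rabs D * Rabs D)
        by (rewrite <- Rabs_mult; apply Rabs_pos_eq; nra).
      pose proof (Rabs_pos D). nra. }
    apply Rle_trans with (e2 * (K * K * n2)); [apply Rmult_le_compat_l; lra|].
    right. unfold e2. field. lra. }
  eapply Rle_trans; [apply Rabs_triang|].
  eapply Rle_trans; [apply Rplus_le_compat_r, Rabs_triang|]. lra.
Qed.

(** [x |-> w + e x] for [s = 1] and its composition with conjugation for [s = -1],
    where [e = e1 + i e2]: conformal or anticonformal either way, so the trace of the
    Hessian only picks up the factor [|e|^2]. *)
Lemma has_lap_affine f (w : C) e1 e2 s z L :
  s * s = 1 ->
  has_lap f (Re w + (e1 * Re z - s * e2 * Im z), Im w + (e2 * Re z + s * e1 * Im z)) L ->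
  has_lap (fun x : C => f (Re w + (e1 * Re x - s * e2 * Im x),
                           Im w + (e2 * Re x + s * e1 * Im x)))
    z ((e1 * e1 + e2 * e2) * L).
Proof.
  intros Hs (p & q & a & b & c & H & HL).
  exists (p * e1 + q * e2), (s * (q * e1 - p * e2)),
    (a * (e1 * e1) + 2 * b * (e1 * e2) + c * (e2 * e2)),
    (s * (- a * (e1 * e2) + b * (e1 * e1 - e2 * e2) + c * (e1 * e2))),
    (a * (e2 * e2) - 2 * b * (e1 * e2) + c * (e1 * e1)).
  split; [|rewrite <- HL; ring].
  intros eps He.
  set (N := e1 * e1 + e2 * e2).
  assert (HN : 0 <= N) by (unfold N; nra).
  destruct (H (eps / (N + 1))) as [d [Hd H']]; [apply Rdiv_lt_0_compat; lra|].
  set (M := Rabs e1 + Rabs e2 + 1).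
  assert (HM : 0 < M) by (unfold M; pose proof (Rabs_pos e1); pose proof (Rabs_pos e2); lra).
  exists (d / M); split; [now apply Rdiv_lt_0_compat|].
  intros h k Hh Hk.
  assert (Hsa : Rabs s = 1).
  { destruct (Rle_dec 0 s).
    - rewrite Rabs_pos_eq by lra. nra.
    - rewrite Rabs_left by lra. nra. }
  assert (Hb : forall x y, Rabs x <= Rabs e1 -> Rabs y <= Rabs e2 ->
     Rabs (x * h + y * k) < d /\ Rabs (y * h + x * k) < d).
  { intros x y Hx Hy. assert (E : M * (d / M) = d) by (field; lra).
    pose proof (Rabs_pos x); pose proof (Rabs_pos y).
    pose proof (Rabs_pos h); pose proof (Rabs_pos k).
    assert (0 < d / M) by (now apply Rdiv_lt_0_compat).
    split; (eapply Rle_lt_trans; [apply Rabs_triang|]); rewrite !Rabs_mult;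
    unfold M in *; nra. }
  specialize (H' (e1 * h - s * e2 * k) (e2 * h + s * e1 * k)).
  assert (A1 : Rabs (e1 * h - s * e2 * k) < d).
  { replace (e1 * h - s * e2 * k) with (e1 * h + (- (s * e2)) * k) by ring.
    apply (Hb e1); [lra|]. rewrite Rabs_Ropp, Rabs_mult, Hsa. lra. }
  assert (A2 : Rabs (e2 * h + s * e1 * k) < d).
  { apply (Hb (s * e1) e2); [|lra]. rewrite Rabs_mult, Hsa. lra. }
  specialize (H' A1 A2). simpl in H'.
  unfold Re, Im in *. cbn [fst snd] in *.
  set (X := fst w + (e1 * fst z - s * e2 * snd z)) in *.
  set (Y := snd w + (e2 * fst z + s * e1 * snd z)) in *.
  replace (fst w + (e1 * (fst z + h) - s * e2 * (snd z + k)))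
    with (X + (e1 * h - s * e2 * k)) by (unfold X; ring).
  replace (snd w + (e2 * (fst z + h) + s * e1 * (snd z + k)))
    with (Y + (e2 * h + s * e1 * k)) by (unfold Y; ring).
  match type of H' with Rabs ?e <= _ => replace (_ - _) with e end.
  - eapply Rle_trans; [exact H'|].
    replace ((e1 * h - s * e2 * k) * (e1 * h - s * e2 * k) +
             (e2 * h + s * e1 * k) * (e2 * h + s * e1 * k))
      with ((e1 * e1 + e2 * e2) * (h * h + (s * s) * (k * k))) by ring.
    rewrite Hs. fold N. rewrite Rmult_1_l.
    replace (eps / (N + 1) * (N * (h * h + k * k)))
      with (eps * (h * h + k * k) * (N / (N + 1))) by (field; lra).
    assert (N / (N + 1) <= 1).
    { apply Rmult_le_reg_r with (N + 1); [lra|]. unfold Rdiv.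
      rewrite Rmult_assoc, Rinv_l by lra. lra. }
    assert (0 <= eps * (h * h + k * k)) by (apply Rmult_le_pos; nra).
    nra.
  - transitivity (f (X + (e1 * h - s * e2 * k), Y + (e2 * h + s * e1 * k)) -
    (f (X, Y) + p * (e1 * h - s * e2 * k) + q * (e2 * h + s * e1 * k) +
     ((a * (e1 * h * (e1 * h)) - 2 * a * (s * (e1 * e2 * h * k)) + a * ((s * s) * (e2 * e2 * k * k)))
      + 2 * b * (e1 * e2 * h * h + s * (e1 * e1 - e2 * e2) * h * k - (s * s) * (e1 * e2 * k * k)) +
      c * (e2 * h * (e2 * h) + 2 * s * (e1 * e2 * h * k) + (s * s) * (e1 * e1 * k * k))) / 2));
    [field|rewrite Hs; field].
Qed.

Lemma has_lap_continuous f z L : has_lap f z L -> continuous f z.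
Proof.
  intros (p & q & a & b & c & H & _).
  apply filterlim_locally. intros eps.
  destruct (H 1 Rlt_0_1) as [d [Hd H']].
  set (K := Rabs p + Rabs q + (Rabs a + 2 * Rabs b + Rabs c) / 2 + 2).
  assert (HK : 2 <= K).
  { unfold K. pose proof (Rabs_pos p); pose proof (Rabs_pos q).
    pose proof (Rabs_pos a); pose proof (Rabs_pos b); pose proof (Rabs_pos c). lra. }
  assert (Hd' : 0 < Rmin (Rmin 1 d) (eps / K)).
  { repeat apply Rmin_pos; try lra. apply Rdiv_lt_0_compat; [apply eps|lra]. }
  exists (mkposreal _ Hd'). intros w [Hw1 Hw2].
  change (Rabs (fst w - fst z) < Rmin (Rmin 1 d) (eps / K)) in Hw1.
  change (Rabs (snd w - snd z) < Rmin (Rmin 1 d) (eps / K)) in Hw2.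
  change (Rabs (f w - f z) < eps).
  set (h := fst w - fst z) in *. set (k := snd w - snd z) in *.
  set (m := Rmin (Rmin 1 d) (eps / K)) in *.
  assert (Hm1 : m <= 1) by (unfold m; eapply Rle_trans; [apply Rmin_l|apply Rmin_l]).
  assert (Hm2 : m <= d) by (unfold m; eapply Rle_trans; [apply Rmin_l|apply Rmin_r]).
  assert (Hm3 : K * m <= eps).
  { apply Rle_trans with (K * (eps / K)); [apply Rmult_le_compat_l; [lra|apply Rmin_r]|].
    right. field. lra. }
  specialize (H' h k ltac:(lra) ltac:(lra)).
  replace (Re z + h, Im z + k) with w in H'
    by (unfold h, k, Re, Im; destruct w; cbn; f_equal; ring).
  match type of H' with Rabs ?e <= _ => set (E := e) in * end.
  replace (f w - f z) with
    (E + (p * h + q * k + (a * (h * h) + 2 * b * (h * k) + c * (k * k)) / 2))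
    by (unfold E; ring).
  pose proof (Rabs_pos h) as P1; pose proof (Rabs_pos k) as P2.
  assert (A1 : h * h = Rabs h * Rabs h) by (rewrite <- Rabs_mult; symmetry; apply Rabs_pos_eq; nra).
  assert (A2 : k * k = Rabs k * Rabs k) by (rewrite <- Rabs_mult; symmetry; apply Rabs_pos_eq; nra).
  assert (B1 : Rabs h * Rabs h <= Rabs h) by nra.
  assert (B2 : Rabs k * Rabs k <= Rabs k) by nra.
  assert (B3 : Rabs h * Rabs k <= Rabs h) by nra.
  eapply Rle_lt_trans; [apply Rabs_triang|].
  eapply Rle_lt_trans; [apply Rplus_le_compat; [exact H'|apply Rabs_triang]|].
  eapply Rle_lt_trans;
    [apply Rplus_le_compat_l, Rplus_le_compat; [apply Rabs_triang|right]|].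
  { unfold Rdiv. rewrite Rabs_mult. rewrite (Rabs_pos_eq (/ 2)) by lra. reflexivity. }
  assert (Rabs (a * (h * h) + 2 * b * (h * k) + c * (k * k))
            <= (Rabs a + 2 * Rabs b + Rabs c) * m).
  { eapply Rle_trans; [apply Rabs_triang|].
    eapply Rle_trans; [apply Rplus_le_compat_r, Rabs_triang|].
    rewrite !Rabs_mult. rewrite (Rabs_pos_eq 2) by lra.
    pose proof (Rabs_pos a); pose proof (Rabs_pos b); pose proof (Rabs_pos c). nra. }
  rewrite !Rabs_mult.
  pose proof (Rabs_pos p); pose proof (Rabs_pos q).
  assert (Rabs p * Rabs h <= Rabs p * m) by nra.
  assert (Rabs q * Rabs k <= Rabs q * m) by nra.
  assert (h * h + k * k < 2 * m) by lra.
  unfold K in Hm3. lra.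
Qed.

Lemma mvt_increment (g dg : R -> R) (t s : R) :
  (forall x, Rabs (x - t) <= Rabs s -> is_derive g x (dg x)) ->
  exists x, Rabs (x - t) <= Rabs s /\ g (t + s) - g t = dg x * s.
Proof.
  intros H.
  assert (B : forall x, Rmin t (t + s) <= x <= Rmax t (t + s) -> Rabs (x - t) <= Rabs s).
  { intros x [H1 H2]. unfold Rmin, Rmax in *.
    destruct (Rle_dec t (t + s)); apply Rabs_le_between;
    [rewrite (Rabs_pos_eq s) by lra|rewrite (Rabs_left s) by lra]; lra. }
  destruct (MVT_gen g t (t + s) dg) as [x [Hx E]].
  - intros x Hx. apply H, B. lra.
  - intros x Hx. apply continuity_pt_filterlim.
    apply (ex_derive_continuous g x). exists (dg x). now apply H, B.
  - exists x. split; [now apply B|]. rewrite E. ring.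
Qed.

(** Mean value theorem for [phi] minus its candidate quadratic polynomial, whose
    derivative is controlled by the hypothesis on [psi]. *)
Lemma taylor_bound (phi psi : R -> R) (t h a eps : R) :
  0 <= eps ->
  (forall x, Rabs (x - t) <= Rabs h -> is_derive phi x (psi x)) ->
  (forall s, Rabs s <= Rabs h -> Rabs (psi (t + s) - psi t - a * s) <= eps * Rabs s) ->
  Rabs (phi (t + h) - (phi t + psi t * h + a * (h * h) / 2)) <= eps * (h * h).
Proof.
  intros He H1 H2.
  destruct (mvt_increment (fun x => phi x - psi t * (x - t) - a * ((x - t) * (x - t)) / 2)
     (fun x => psi x - psi t - a * (x - t)) t h) as [x [Hx E]].
  { intros x Hx. specialize (H1 x Hx). auto_derive; [now exists (psi x)|].
    replace (Derive (fun x0 : R => phi x0) x) with (psi x)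
      by (symmetry; now apply is_derive_unique). field. }
  replace (phi (t + h) - (phi t + psi t * h + a * (h * h) / 2))
    with (phi (t + h) - psi t * (t + h - t) - a * ((t + h - t) * (t + h - t)) / 2 -
     (phi t - psi t * (t - t) - a * ((t - t) * (t - t)) / 2)) by field.
  rewrite E.
  specialize (H2 (x - t) Hx). replace (t + (x - t)) with x in H2 by ring.
  rewrite Rabs_mult.
  replace (h * h) with (Rabs h * Rabs h) by (rewrite <- Rabs_mult; apply Rabs_pos_eq; nra).
  assert (0 <= eps * Rabs (x - t)) by (eapply Rle_trans; [apply Rabs_pos|exact H2]).
  pose proof (Rabs_pos h) as Ph; pose proof (Rabs_pos (x - t)) as Px.
  rewrite <- Rmult_assoc. apply Rmult_le_compat_r; [exact Ph|].
  eapply Rle_trans; [exact H2|].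
  now apply Rmult_le_compat_l.
Qed.

Lemma jet1_of_derive (phi psi : R -> R) (t a r : R) :
  0 < r ->
  (forall x, Rabs (x - t) < r -> is_derive phi x (psi x)) ->
  is_derive psi t a -> jet1 phi t (psi t) a.
Proof.
  intros Hr H1 H2 eps He.
  apply is_derive_Reals in H2.
  destruct (H2 eps He) as [d Hd].
  exists (Rmin r d); split; [apply Rmin_pos; [exact Hr|apply d]|].
  intros h Hh. pose proof (Rmin_l r d); pose proof (Rmin_r r d).
  apply (taylor_bound phi psi); [lra| |].
  - intros x Hx. apply H1. lra.
  - intros s Hs. destruct (Req_dec s 0) as [->|Hs0].
    { rewrite Rplus_0_r. replace (psi t - psi t - a * 0) with 0 by ring.
      rewrite Rabs_R0. lra. }
    specialize (Hd s Hs0 ltac:(lra)).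
    replace (psi (t + s) - psi t - a * s) with (((psi (t + s) - psi t) / s - a) * s)
      by (field; exact Hs0).
    rewrite Rabs_mult. apply Rmult_le_compat_r; [apply Rabs_pos|lra].
Qed.

Lemma locally_box (z : C) (P : C -> Prop) :
  locally z P <-> exists d, 0 < d /\
    forall x y, Rabs (x - Re z) < d -> Rabs (y - Im z) < d -> P (x, y).
Proof.
  split.
  - intros [d Hd]. exists d; split; [apply d|]. intros x y Hx Hy.
    apply Hd. split; assumption.
  - intros [d [Hd H]]. exists (mkposreal d Hd). intros w [H1 H2].
    rewrite <- (C_eta w). now apply H.
Qed.

(** Move vertically along [x = Re z], then horizontally at height [y + k]. The mixed
    derivative enters when [dx f] is carried from height [y + k] back to [y]. *)
Lemma C2_has_lap U f z :
  C2_on U f -> locally z U -> has_lap f z (laplacian f z).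
Proof.
  intros (Hf & Hfx & Hfy) HU.
  apply locally_box in HU. destruct HU as [r [Hr HU]].
  set (x := Re z) in *. set (y := Im z) in *.
  assert (Ez : (x, y) = z) by apply C_eta.
  assert (Uz : U z) by (rewrite <- (C_eta z); apply HU; fold x y; rewrite Rminus_diag, Rabs_R0; exact Hr).
  exists (dx f z), (dy f z), (dx (dx f) z), (dy (dx f) z), (dy (dy f) z).
  split; [|reflexivity].
  intros eps He.
  destruct (Hfx z Uz) as (_ & _ & _ & Cxx & Cxy).
  assert (He4 : 0 < eps / 4) by lra.
  apply (filterlim_locally (dx (dx f))) with (eps := mkposreal _ He4) in Cxx.
  apply (filterlim_locally (dy (dx f))) with (eps := mkposreal _ He4) in Cxy.
  apply locally_box in Cxx. destruct Cxx as [d1 [Hd1 Cxx]].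
  apply locally_box in Cxy. destruct Cxy as [d2 [Hd2 Cxy]].
  fold x y in Cxx, Cxy.
  assert (J : jet1 (fun t => f (x, t)) y (dy f z) (dy (dy f) z)).
  { replace (dy f z) with (dy f (x, y)) by (now rewrite Ez).
    apply (jet1_of_derive (fun t => f (x, t)) (fun t => dy f (x, t)) y _ r Hr).
    - intros t Ht. unfold dy. apply Derive_correct.
      apply (Hf (x, t)). apply HU; [rewrite Rminus_diag, Rabs_R0; exact Hr|exact Ht].
    - unfold dy at 2. apply Derive_correct. apply (Hfy z Uz). }
  destruct (J (eps / 4) He4) as [d3 [Hd3 H3]].
  exists (Rmin (Rmin r d1) (Rmin d2 d3)); split; [repeat apply Rmin_pos; assumption|].
  intros h k Hh Hk.
  assert (M : Rmin (Rmin r d1) (Rmin d2 d3) <= r /\ Rmin (Rmin r d1) (Rmin d2 d3) <= d1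
    /\ Rmin (Rmin r d1) (Rmin d2 d3) <= d2 /\ Rmin (Rmin r d1) (Rmin d2 d3) <= d3).
  { repeat split; first [eapply Rle_trans; [apply Rmin_l|apply Rmin_l]
     |eapply Rle_trans; [apply Rmin_l|apply Rmin_r]
     |eapply Rle_trans; [apply Rmin_r|apply Rmin_l]
     |eapply Rle_trans; [apply Rmin_r|apply Rmin_r]]. }
  destruct M as (M1 & M2 & M3 & M4).
  specialize (H3 k ltac:(lra)). cbv beta in H3.
  assert (Ky : Rabs (y + k - y) = Rabs k) by (f_equal; ring).
  assert (T1 : Rabs (f (x + h, y + k) - (f (x, y + k) + dx f (x, y + k) * h
       + dx (dx f) z * (h * h) / 2)) <= eps / 4 * (h * h)).
  { apply (taylor_bound (fun t => f (t, y + k)) (fun t => dx f (t, y + k)) x h); [lra| |].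
    - intros t Ht. unfold dx. apply Derive_correct. apply (Hf (t, y + k)).
      apply HU; lra.
    - intros s Hs.
      destruct (mvt_increment (fun t => dx f (t, y + k)) (fun t => dx (dx f) (t, y + k)) x s)
        as [t [Ht E]].
      { intros t Ht. apply Derive_correct. apply (Hfx (t, y + k)).
        apply HU; lra. }
      cbv beta in E. cbv beta. rewrite E. specialize (Cxx t (y + k) ltac:(lra) ltac:(lra)).
      change (Rabs (dx (dx f) (t, y + k) - dx (dx f) z) < eps / 4) in Cxx.
      replace (_ - _) with ((dx (dx f) (t, y + k) - dx (dx f) z) * s) by ring.
      rewrite Rabs_mult. apply Rmult_le_compat_r; [apply Rabs_pos|lra]. }
  assert (T2 : Rabs (dx f (x, y + k) - dx f (x, y) - dy (dx f) z * k) <= eps / 4 * Rabs k).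
  { destruct (mvt_increment (fun t => dx f (x, t)) (fun t => dy (dx f) (x, t)) y k)
      as [t [Ht E]].
    { intros t Ht. unfold dy. apply Derive_correct. apply (Hfx (x, t)).
      apply HU; [rewrite Rminus_diag, Rabs_R0; exact Hr|lra]. }
    rewrite E. specialize (Cxy x t ltac:(rewrite Rminus_diag, Rabs_R0; exact Hd2) ltac:(lra)).
    change (Rabs (dy (dx f) (x, t) - dy (dx f) z) < eps / 4) in Cxy.
    replace (_ - _) with ((dy (dx f) (x, t) - dy (dx f) z) * k) by ring.
    rewrite Rabs_mult. apply Rmult_le_compat_r; [apply Rabs_pos|lra]. }
  assert (T3 : Rabs ((dx f (x, y + k) - dx f (x, y) - dy (dx f) z * k) * h)
     <= eps / 4 * (h * h + k * k)).
  { rewrite Rabs_mult. pose proof (Rabs_pos h); pose proof (Rabs_pos k).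
    assert (A1 : h * h = Rabs h * Rabs h) by (rewrite <- Rabs_mult; symmetry; apply Rabs_pos_eq; nra).
    assert (A2 : k * k = Rabs k * Rabs k) by (rewrite <- Rabs_mult; symmetry; apply Rabs_pos_eq; nra).
    rewrite A1, A2.
    apply Rle_trans with (eps / 4 * Rabs k * Rabs h); [now apply Rmult_le_compat_r|].
    rewrite Rmult_assoc. apply Rmult_le_compat_l; [lra|]. nra. }
  rewrite ?Ez in T3. rewrite ?Ez in H3.
  match type of T1 with Rabs ?e <= _ => set (E1 := e) in * end.
  match type of T3 with Rabs ?e <= _ => set (E3 := e) in * end.
  match type of H3 with Rabs ?e <= _ => set (E2 := e) in * end.
  replace (_ - _) with (E1 + E2 + E3); [|unfold E1, E2, E3; fold x y; field].
  eapply Rle_trans; [apply Rabs_triang|].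
  eapply Rle_trans; [apply Rplus_le_compat_r, Rabs_triang|].
  assert (0 <= h * h) by nra. assert (0 <= k * k) by nra.
  nra.
Qed.

(** * Maximum principle *)

(** Heine-Borel in the form used below: a property with a margin [d] that holds
    near each point of a compact set holds on the whole set with one margin. *)
Lemma compact_uniform (K : C -> Prop) (M : R) (Q : R -> C -> Prop) :
  (forall z, K z -> Rabs (Re z) <= M /\ Rabs (Im z) <= M) ->
  closed K ->
  (forall d d' z, 0 < d -> d <= d' -> Q d' z -> Q d z) ->
  (forall z, K z -> exists d, 0 < d /\ locally z (fun w => K w -> Q d w)) ->
  exists d, 0 < d /\ forall z, K z -> Q d z.
Proof.
  intros HM HK Hmono Hloc.
  assert (Hd : forall u v : R, exists d : posreal, forall x y,
     Rabs (x - u) < d -> Rabs (y - v) < d -> K (x, y) -> Q d (x, y)).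
  { intros u v. destruct (classic (K (u, v))) as [Kz|Kz].
    - destruct (Hloc _ Kz) as [d [Hd H]].
      apply locally_box in H. destruct H as [d' [Hd' H]]. cbn in H.
      exists (mkposreal _ (Rmin_pos _ _ Hd Hd')). cbn.
      pose proof (Rmin_l d d'); pose proof (Rmin_r d d').
      intros x y Hx Hy Kxy. apply Hmono with d; [now apply Rmin_pos|lra|].
      apply H; [lra|lra|exact Kxy].
    - assert (H : locally ((u, v) : C) (fun w => ~ K w)).
      { apply NNPP. intros H. now apply Kz, HK. }
      apply locally_box in H. destruct H as [d [Hd H]]. cbn in H.
      exists (mkposreal d Hd). cbn. intros x y Hx Hy Kxy.
      exfalso. now apply (H x y). }
  set (delta := fun u v => proj1_sig (constructive_indefinite_description _ (Hd u v))).
  destruct (compactness_value_2d (- M) M (- M) M delta) as [d H].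
  exists d; split; [apply d|].
  intros z Kz. destruct (HM z Kz) as [H1 H2].
  apply Rabs_le_between in H1. apply Rabs_le_between in H2.
  apply NNPP. intros HQ. apply (H (Re z) (Im z) H1 H2).
  intros (u & v & _ & _ & Hx & Hy & Hdd).
  apply HQ. apply Hmono with (delta u v); [apply d|exact Hdd|].
  unfold delta in *.
  destruct (constructive_indefinite_description _ (Hd u v)) as [dd Hdd']. cbn in *.
  rewrite <- (C_eta z). apply Hdd'; [exact Hx|exact Hy|now rewrite C_eta].
Qed.

Lemma continuous_lt_margin (f : C -> R) z l :
  continuous f z -> f z < l -> exists d, 0 < d /\ locally z (fun w => f w < l - d).
Proof.
  intros Hc Hl. assert (He : 0 < (l - f z) / 2) by lra.
  exists ((l - f z) / 2); split; [exact He|].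
  apply (filterlim_locally f) with (eps := mkposreal _ He) in Hc.
  revert Hc. apply filter_imp. intros w Hw.
  change (Rabs (f w - f z) < (l - f z) / 2) in Hw.
  apply Rabs_lt_between in Hw. lra.
Qed.

(** A first pass of [compact_uniform] bounds [f]; if the supremum [S] were not
    attained, a second pass would bound [f] by some [S - d]. *)
Lemma compact_max (K : C -> Prop) (M : R) (f : C -> R) :
  (forall z, K z -> Rabs (Re z) <= M /\ Rabs (Im z) <= M) ->
  closed K -> (exists z, K z) ->
  (forall z, K z -> continuous f z) ->
  exists z, K z /\ forall w, K w -> f w <= f z.
Proof.
  intros HM HK [z0 K0] Hc.
  destruct (compact_uniform K M (fun d z => f z <= / d) HM HK) as [d [Hd Hb]].
  { intros d d' z Hd Hdd H. eapply Rle_trans; [exact H|]. now apply Rinv_le_contravar. }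
  { intros z Kz.
    assert (P : 0 < Rabs (f z) + 1) by (pose proof (Rabs_pos (f z)); lra).
    exists (/ (Rabs (f z) + 1)); split; [now apply Rinv_0_lt_compat|].
    destruct (continuous_lt_margin f z (Rabs (f z) + 1) (Hc z Kz)) as [d [Hd H]].
    { pose proof (Rle_abs (f z)). lra. }
    revert H. apply filter_imp. intros w Hw _. rewrite Rinv_inv. lra. }
  destruct (completeness (fun y => exists z, K z /\ y = f z)) as [S [HS1 HS2]].
  { exists (/ d). intros y (z & Kz & ->). now apply Hb. }
  { exists (f z0), z0. now split. }
  apply NNPP. intros HN.
  assert (Hlt : forall z, K z -> f z < S).
  { intros z Kz. destruct (Rlt_dec (f z) S) as [H|H]; [exact H|].
    exfalso. apply HN. exists z. split; [exact Kz|].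
    intros w Kw. apply Rle_trans with S; [|lra]. apply HS1. now exists w. }
  destruct (compact_uniform K M (fun d z => f z <= S - d) HM HK) as [d' [Hd' Hb']].
  { intros e e' z _ Hee H. lra. }
  { intros z Kz. destruct (continuous_lt_margin f z S (Hc z Kz) (Hlt z Kz)) as [e [He H]].
    exists e; split; [exact He|]. revert H. apply filter_imp. intros w Hw _. lra. }
  assert (S <= S - d'); [|lra].
  apply HS2. intros y (z & Kz & ->). now apply Hb'.
Qed.

Lemma local_max_lap f z L :
  has_lap f z L -> locally z (fun w => f w <= f z) -> L <= 0.
Proof.
  intros (p & q & a & b & c & H & HL) Hm.
  apply locally_box in Hm. destruct Hm as [d0 [Hd0 Hm]].
  destruct (Rle_dec L 0) as [H0|H0]; [exact H0|exfalso].
  destruct (H (L / 8)) as [d [Hd H']]; [lra|].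
  set (m := Rmin d d0 / 2).
  pose proof (Rmin_l d d0); pose proof (Rmin_r d d0); pose proof (Rmin_pos d d0 Hd Hd0).
  assert (Hmm : 0 < m) by (unfold m; lra).
  assert (A : Rabs m < Rmin d d0) by (rewrite Rabs_pos_eq; unfold m; lra).
  assert (A' : Rabs (- m) < Rmin d d0) by (now rewrite Rabs_Ropp).
  assert (A0 : Rabs 0 < Rmin d d0) by (now rewrite Rabs_R0).
  assert (G : forall h k, Rabs h < Rmin d d0 -> Rabs k < Rmin d d0 ->
     p * h + q * k + (a * (h * h) + 2 * b * (h * k) + c * (k * k)) / 2
      <= L / 8 * (h * h + k * k)).
  { intros h k Hh Hk. specialize (H' h k ltac:(lra) ltac:(lra)).
    specialize (Hm (Re z + h) (Im z + k)).
    assert (f (Re z + h, Im z + k) <= f z).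
    { apply Hm; [replace (Re z + h - Re z) with h by ring|replace (Im z + k - Im z) with k by ring]; lra. }
    apply Rabs_le_between in H'. lra. }
  pose proof (G m 0 A A0). pose proof (G (- m) 0 A' A0).
  pose proof (G 0 m A0 A). pose proof (G 0 (- m) A0 A').
  assert (0 < m * m) by nra.
  assert ((a + c) * (m * m) <= L / 2 * (m * m)) by lra.
  rewrite HL in *. nra.
Qed.

(** A positive maximum of [f] would lie in the interior of [K], with a positive
    Laplacian, against [local_max_lap]. Asking for the sign of the Laplacian only where
    [f] is positive is what makes semilinear comparison possible. *)
Lemma max_principle (K : C -> Prop) (M : R) (f : C -> R) :
  (forall z, K z -> Rabs (Re z) <= M /\ Rabs (Im z) <= M) ->
  closed K ->
  (forall z, K z -> exists L, has_lap f z L /\ (0 < f z -> locally z K /\ 0 < L)) ->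
  forall z, K z -> f z <= 0.
Proof.
  intros HM HK H z Kz.
  destruct (compact_max K M f HM HK) as [z1 [Kz1 Hmax]].
  { now exists z. }
  { intros w Kw. destruct (H w Kw) as [L [HL _]]. now apply has_lap_continuous with L. }
  apply Rle_trans with (f z1); [now apply Hmax|].
  destruct (Rle_dec (f z1) 0) as [H0|H0]; [exact H0|exfalso].
  destruct (H z1 Kz1) as [L [HL HL']].
  destruct HL' as [Hloc HL']; [lra|].
  assert (L <= 0); [|lra].
  apply (local_max_lap f z1 L HL).
  revert Hloc. apply filter_imp. exact Hmax.
Qed.

(** * Polynomial and radial functions *)

Definition sqnorm (z : C) : R := Re z * Re z + Im z * Im z.

Lemma sqnorm_Cmod z : sqnorm z = Cmod z * Cmod z.
Proof.
  unfold sqnorm, Cmod, Re, Im. rewrite sqrt_sqrt; [ring|]. nra.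
Qed.

Lemma has_lap_quadratic l0 l1 l2 m1 m2 z :
  has_lap (fun w => l0 + l1 * Re w + l2 * Im w + m1 * (Re w * Re w) + m2 * (Im w * Im w))
    z (2 * m1 + 2 * m2).
Proof.
  exists (l1 + 2 * m1 * Re z), (l2 + 2 * m2 * Im z), (2 * m1), 0, (2 * m2).
  split; [|reflexivity].
  intros eps He. exists 1; split; [lra|]. intros h k _ _. cbn.
  replace (_ - _) with 0 by (unfold Re, Im; field).
  rewrite Rabs_R0. apply Rmult_le_pos; nra.
Qed.

Lemma jet_sqnorm z : jet sqnorm z (2 * Re z) (2 * Im z) 2 0 2.
Proof.
  intros eps He. exists 1; split; [lra|]. intros h k _ _. unfold sqnorm. cbn.
  replace (_ - _) with 0 by (unfold Re, Im; field).
  rewrite Rabs_R0. apply Rmult_le_pos; nra.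
Qed.

Lemma has_lap_sqnorm z : has_lap sqnorm z 4.
Proof.
  exists (2 * Re z), (2 * Im z), 2, 0, 2. split; [apply jet_sqnorm|lra].
Qed.

(** Position along the cylinder [(0, +oo) x circle] onto which the logarithm maps the
    punctured unit disc; the puncture is the end [tau = +oo]. *)
Definition tau (z : C) : R := - ln (Cmod z).

Lemma exp_tau z : 0 < Cmod z -> exp (- tau z) = Cmod z.
Proof. intros H. unfold tau. rewrite Ropp_involutive. now apply exp_ln. Qed.

Lemma exp_2tau z : 0 < Cmod z -> exp (2 * tau z) = / (Cmod z * Cmod z).
Proof.
  intros H. rewrite <- (exp_tau z H), <- exp_plus, <- exp_Ropp. f_equal. ring.
Qed.

Lemma tau_lt_iff z t : 0 < Cmod z -> (t < tau z <-> Cmod z < exp (- t)).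
Proof.
  intros H. rewrite <- (exp_tau z H). split; intros K.
  - apply exp_increasing. lra.
  - apply exp_lt_inv in K. lra.
Qed.

Lemma exp_le_iff (x y : R) : exp x <= exp y <-> x <= y.
Proof.
  split; intros H.
  - destruct (Rle_dec x y) as [K|K]; [exact K|].
    assert (exp y < exp x) by (apply exp_increasing; lra). lra.
  - destruct (Rle_lt_or_eq_dec _ _ H) as [K|K]; [|subst; lra].
    left. now apply exp_increasing.
Qed.

Lemma tau_le_iff z t : 0 < Cmod z -> (t <= tau z <-> Cmod z <= exp (- t)).
Proof.
  intros H. rewrite <- (exp_tau z H). split; intros K.
  - apply exp_le_iff. lra.
  - apply (proj1 (exp_le_iff _ _)) in K. lra.
Qed.

Lemma tau_ge_iff z t : 0 < Cmod z -> (tau z <= t <-> exp (- t) <= Cmod z).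
Proof.
  intros H. rewrite <- (exp_tau z H). split; intros K.
  - apply exp_le_iff. lra.
  - apply (proj1 (exp_le_iff _ _)) in K. lra.
Qed.

Lemma tau_eq z t : Cmod z = exp (- t) -> tau z = t.
Proof. intros H. unfold tau. rewrite H, ln_exp. ring. Qed.

(** In the coordinate [tau] the plane is a cylinder, and the Laplacian of the
    cylinder is [|z|^2] times that of the plane. *)
Lemma has_lap_radial (phi psi : R -> R) a r z :
  0 < Cmod z -> 0 < r ->
  (forall t, Rabs (t - tau z) < r -> is_derive phi t (psi t)) ->
  is_derive psi (tau z) a ->
  has_lap (fun w => phi (tau w)) z (a * exp (2 * tau z)).
Proof.
  intros Hz Hr H1 H2.
  assert (Hs : 0 < sqnorm z) by (rewrite sqnorm_Cmod; nra).
  assert (J : jet1 (fun s => - (ln s / 2)) (sqnorm z) (- (1 / (2 * sqnorm z)))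
               (1 / (2 * (sqnorm z * sqnorm z)))).
  { apply (jet1_of_derive (fun s => - (ln s / 2)) (fun s => - (1 / (2 * s))) (sqnorm z) _ (sqnorm z));
      [exact Hs| |].
    - intros x Hx. apply Rabs_lt_between in Hx. auto_derive; [lra|]. field. lra.
    - auto_derive; [lra|]. field. lra. }
  assert (E : forall w, - (ln (sqnorm w) / 2) = tau w).
  { intros w. unfold tau. rewrite sqnorm_Cmod.
    destruct (Rle_lt_or_eq_dec 0 (Cmod w) (Cmod_ge_0 w)) as [H|H].
    - rewrite ln_mult by exact H. field.
    - rewrite <- H, Rmult_0_l. replace (ln 0) with 0; [field|]. unfold ln.
      destruct (Rlt_dec 0 0) as [K|K]; [exfalso; exact (Rlt_irrefl 0 K)|reflexivity]. }
  pose proof (jet_comp _ _ _ _ _ _ _ _ _ _ (jet_sqnorm z) J) as J1.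
  apply (jet_ext _ tau) in J1; [|exact E].
  assert (J2 : jet1 phi (tau z) (psi (tau z)) a) by (now apply (jet1_of_derive phi psi _ _ r)).
  pose proof (jet_comp _ _ _ _ _ _ _ _ _ _ J1 J2) as J3.
  do 5 eexists. split; [exact J3|].
  rewrite exp_2tau, <- sqnorm_Cmod by exact Hz.
  set (s := sqnorm z) in *. set (P := psi (tau z)).
  transitivity (a * ((Re z * Re z + Im z * Im z) * / (s * s)) +
    P * ((Re z * Re z + Im z * Im z) * 2 / (s * s) - 2 / s)).
  - field. lra.
  - change (Re z * Re z + Im z * Im z) with s. field. lra.
Qed.

Lemma has_lap_similarity f (c e z : C) L :
  has_lap f (c + e * z)%C L ->
  has_lap (fun w => f (c + e * w)%C) z (Cmod e * Cmod e * L).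
Proof.
  intros H. rewrite <- sqnorm_Cmod.
  assert (E : forall w, (Re c + (Re e * Re w - 1 * Im e * Im w),
     Im c + (Im e * Re w + 1 * Re e * Im w)) = (c + e * w)%C).
  { intros w. unfold Re, Im, Cplus, Cmult. cbn. f_equal; ring. }
  apply has_lap_ext with (fun w : C => f (Re c + (Re e * Re w - 1 * Im e * Im w),
     Im c + (Im e * Re w + 1 * Re e * Im w))).
  { intros w. now rewrite E. }
  apply (has_lap_affine f c (Re e) (Im e) 1 z L); [ring|]. now rewrite E.
Qed.

Lemma has_lap_reflection f (c e z : C) L :
  has_lap f (c + e * Cconj z)%C L ->
  has_lap (fun w => f (c + e * Cconj w)%C) z (Cmod e * Cmod e * L).
Proof.
  intros H. rewrite <- sqnorm_Cmod.
  assert (E : forall w, (Re c + (Re e * Re w - (-1) * Im e * Im w),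
     Im c + (Im e * Re w + (-1) * Re e * Im w)) = (c + e * Cconj w)%C).
  { intros w. unfold Re, Im, Cplus, Cmult, Cconj. cbn. f_equal; ring. }
  apply has_lap_ext with (fun w : C => f (Re c + (Re e * Re w - (-1) * Im e * Im w),
     Im c + (Im e * Re w + (-1) * Re e * Im w))).
  { intros w. now rewrite E. }
  apply (has_lap_affine f c (Re e) (Im e) (-1) z L); [ring|]. now rewrite E.
Qed.

(** * Discs, annuli and circles *)

Lemma continuous_Cmod z : continuous Cmod z.
Proof.
  apply (filterlim_norm (K := C_AbsRing) (V := C_NormedModule) z).
Qed.

Lemma closed_Cmod_le r : closed (fun z => Cmod z <= r).
Proof. apply (closed_comp Cmod (fun x => x <= r)); [exact continuous_Cmod|apply closed_le]. Qed.

Lemma closed_annulus r1 r2 : closed (fun z => r1 <= Cmod z <= r2).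
Proof.
  apply closed_and; [|apply closed_Cmod_le].
  apply (closed_comp Cmod (fun x => r1 <= x)); [exact continuous_Cmod|apply closed_ge].
Qed.

Lemma locally_annulus r1 r2 z :
  r1 < Cmod z < r2 -> locally z (fun w => r1 <= Cmod w <= r2).
Proof.
  intros [H1 H2].
  assert (A : locally z (fun w => r1 < Cmod w)) by
    exact (continuous_Cmod z (fun x => r1 < x) (open_gt r1 _ H1)).
  assert (B : locally z (fun w => Cmod w < r2)) by
    exact (continuous_Cmod z (fun x => x < r2) (open_lt r2 _ H2)).
  generalize (filter_and _ _ A B). apply filter_imp. intros w [? ?]. lra.
Qed.

Lemma Cmod_bounds z r : Cmod z <= r -> Rabs (Re z) <= r /\ Rabs (Im z) <= r.
Proof.
  intros H. pose proof (Rmax_Cmod z).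
  split; (eapply Rle_trans; [|exact H]); (eapply Rle_trans; [|exact H0]);
  [apply Rmax_l|apply Rmax_r].
Qed.

Lemma max_principle_annulus r1 r2 (f : C -> R) :
  (forall z, r1 <= Cmod z <= r2 -> exists L, has_lap f z L /\
     (0 < f z -> r1 < Cmod z < r2 /\ 0 < L)) ->
  forall z, r1 <= Cmod z <= r2 -> f z <= 0.
Proof.
  intros H. apply (max_principle _ r2 f).
  - intros z [_ Hz]. now apply Cmod_bounds.
  - apply closed_annulus.
  - intros z Hz. destruct (H z Hz) as [L [HL H']]. exists L. split; [exact HL|].
    intros Hf. destruct (H' Hf). split; [now apply locally_annulus|assumption].
Qed.

Lemma circle_sup_max (u : C -> R) r :
  0 <= r -> (forall z, Cmod z = r -> continuous u z) ->
  (forall z, Cmod z = r -> u z <= circle_sup u r) /\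
  exists z, Cmod z = r /\ u z = circle_sup u r.
Proof.
  intros Hr Hc.
  destruct (compact_max (fun z => r <= Cmod z <= r) r u) as [z [Hz Hmax]].
  { intros z [_ Hz]. now apply Cmod_bounds. }
  { apply closed_annulus. }
  { exists (RtoC r). rewrite Cmod_R, Rabs_pos_eq; lra. }
  { intros z Hz. apply Hc. lra. }
  assert (E : circle_sup u r = u z).
  { unfold circle_sup. rewrite (is_lub_Rbar_unique _ (Finite (u z))); [reflexivity|].
    split.
    - intros y (w & Hw & ->). apply Hmax. lra.
    - intros b Hb. apply (Hb (u z)). exists z. split; [lra|reflexivity]. }
  rewrite E. split.
  - intros w Hw. apply Hmax. lra.
  - exists z. split; [lra|reflexivity].
Qed.

(** * Harnack inequality *)

Lemma has_lap_tau z : 0 < Cmod z -> has_lap tau z 0.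
Proof.
  intros Hz. rewrite <- (Rmult_0_l (exp (2 * tau z))).
  apply (has_lap_radial (fun t => t) (fun _ => 1) 0 1 z Hz Rlt_0_1).
  - intros t _. auto_derive; auto.
  - auto_derive; auto.
Qed.

Lemma half_disc_closed : closed (fun z : C => Cmod z <= 1 /\ 0 <= Im z).
Proof.
  apply closed_and; [apply closed_Cmod_le|].
  apply (closed_comp Im (fun x => 0 <= x)); [|apply closed_ge].
  intros z. destruct z as [x y]. apply (continuous_snd x y).
Qed.

Lemma half_disc_interior z :
  Cmod z < 1 -> 0 < Im z -> locally z (fun w : C => Cmod w <= 1 /\ 0 <= Im w).
Proof.
  intros H1 H2.
  pose proof (continuous_Cmod z (fun x => x < 1) (open_lt 1 _ H1)) as A.
  assert (B : locally z (fun w : C => 0 < Im w)).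
  { destruct z as [x y]. exact (continuous_snd x y (fun t => 0 < t) (open_gt 0 _ H2)). }
  generalize (filter_and (fun w => Cmod w < 1) _ A B). apply filter_imp.
  intros w [? ?]. split; lra.
Qed.

(** Compare [w] with its mirror image in the bisector of [p] and [q]. The difference
    vanishes on the bisector and is at most [N] on the half disc; in coordinates where
    the disc is the unit disc and the bisector the real axis, it is dominated by
    [N (x^2 + y^2 + 3 (y - y^2))], which is strictly superharmonic, nonnegative on the
    axis and at least [N] on the unit half circle. At [(0, y0)] this is at most
    [3 N y0]. *)
Lemma bisector_estimate (w : C -> R) (p q : C) (rho N eps : R) :
  0 < rho -> p <> q -> Cmod (p - q) <= 2 * rho -> eps * (rho * rho) < N ->
  (forall z, Cmod (z - (p + q) / 2) <= rho ->
     0 <= w z <= N /\ exists L, has_lap w z L /\ Rabs L <= eps) ->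
  w p - w q <= 3 * N * Cmod (p - q) / (2 * rho).
Proof.
  intros Hrho Hpq Hd HN Hw.
  assert (Hpq0 : 0 < Cmod (p - q)).
  { apply Cmod_gt_0. intros H. apply Hpq.
    replace p with ((p - q) + q)%C by ring. rewrite H. ring. }
  set (m := ((p + q) / 2)%C).
  set (y0 := Cmod (p - q) / (2 * rho)).
  assert (Hy0 : 0 < y0) by (apply Rdiv_lt_0_compat; lra).
  assert (Hy1 : y0 <= 1).
  { apply Rmult_le_reg_r with (2 * rho); [lra|]. unfold y0.
    replace (Cmod (p - q) / (2 * rho) * (2 * rho)) with (Cmod (p - q)) by (field; lra). lra. }
  assert (Hy0c : RtoC y0 <> 0%C) by (intros E; apply RtoC_inj in E; lra).
  set (e := ((p - q) / (2 * Ci * RtoC y0))%C).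
  assert (HCi : Ci <> 0%C) by (intros E; injection E; lra).
  assert (H2 : RtoC 2 <> 0%C) by (intros E; apply RtoC_inj in E; lra).
  assert (He : Cmod e = rho).
  { unfold e. rewrite Cmod_div; [|repeat apply Cmult_neq_0; assumption].
    rewrite !Cmod_mult, !Cmod_R, (Rabs_pos_eq 2), (Rabs_pos_eq y0) by lra.
    replace (Cmod Ci) with 1.
    - unfold y0. field. lra.
    - unfold Cmod, Ci. cbn. replace (0 * (0 * 1) + 1 * (1 * 1)) with 1 by ring.
      now rewrite sqrt_1. }
  assert (Ep : (m + e * (0, y0))%C = p).
  { replace ((0, y0) : C) with (Ci * RtoC y0)%C
      by (unfold Ci, RtoC, Cmult; cbn; f_equal; ring).
    unfold m, e. field. split; assumption. }
  assert (Eq : (m + e * Cconj (0, y0))%C = q).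
  { replace (Cconj (0, y0)) with (- (Ci * RtoC y0))%C
      by (unfold Ci, RtoC, Cmult, Cconj, Copp; cbn; f_equal; ring).
    unfold m, e. field. split; assumption. }
  assert (Hin : forall z, Cmod z <= 1 -> Cmod ((m + e * z) - m) <= rho).
  { intros z Hz. replace ((m + e * z) - m)%C with (e * z)%C by ring.
    rewrite Cmod_mult, He. nra. }
  assert (Hcj : forall z, Cmod (Cconj z) = Cmod z).
  { intros z. unfold Cmod, Cconj. cbn. f_equal. ring. }
  assert (HN0 : 0 < N).
  { destruct (Hw m) as [_ (L & _ & HL)].
    - replace (m - (p + q) / 2)%C with (RtoC 0) by (unfold m; ring). rewrite Cmod_0. lra.
    - pose proof (Rabs_pos L). nra. }
  (* the coefficient of y^2 in the barrier is N (1 - 3) *)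
  set (f := fun z : C => w (m + e * z)%C - w (m + e * Cconj z)%C -
     (0 + 0 * Re z + 3 * N * Im z + N * (Re z * Re z) + (-2 * N) * (Im z * Im z))).
  assert (Hf : forall z, Cmod z <= 1 /\ 0 <= Im z -> f z <= 0).
  { apply (max_principle _ 1 f).
    - intros z [Hz _]. now apply Cmod_bounds.
    - apply half_disc_closed.
    - intros z [Hz Hz0].
      destruct (Hw (m + e * z)%C) as [W1 (L1 & HL1 & B1)]; [now apply Hin|].
      destruct (Hw (m + e * Cconj z)%C) as [W2 (L2 & HL2 & B2)]; [apply Hin; now rewrite Hcj|].
      apply has_lap_similarity in HL1. apply has_lap_reflection in HL2. rewrite He in *.
      exists (rho * rho * L1 - rho * rho * L2 - (2 * N + 2 * (-2 * N))).
      split.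
      { apply has_lap_minus; [now apply has_lap_minus|apply has_lap_quadratic]. }
      intros Hpos. unfold f in Hpos.
      assert (Sq : Re z * Re z + Im z * Im z = Cmod z * Cmod z) by apply sqnorm_Cmod.
      split.
      + apply half_disc_interior.
        * apply Rnot_le_lt. intros H1. assert (Cmod z = 1) by lra.
          rewrite H in Sq. assert (Im z <= 1) by nra.
          assert (Re z * Re z = 1 - Im z * Im z) by lra.
          rewrite H3 in Hpos. assert (0 <= N * (Im z * (1 - Im z)))
            by (repeat apply Rmult_le_pos; lra). lra.
        * apply Rnot_le_lt. intros H1. assert (Im z = 0) by lra.
          assert (E : Cconj z = z).
          { destruct z as [zx zy]. unfold Cconj, Im in *. cbn in *. subst zy. f_equal. ring. }
          rewrite E, H in Hpos. assert (0 <= N * (Re z * Re z)) by nra. nra.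
      + apply Rabs_le_between in B1. apply Rabs_le_between in B2.
        assert (0 < rho * rho) by nra. nra. }
  specialize (Hf (0, y0)). unfold f in Hf. rewrite Ep, Eq in Hf.
  unfold Re, Im in Hf. cbn in Hf.
  assert (Hy : Cmod (0, y0) <= 1).
  { unfold Cmod. cbn. replace (0 * (0 * 1) + y0 * (y0 * 1)) with (Rsqr y0) by (unfold Rsqr; ring).
    rewrite sqrt_Rsqr; lra. }
  specialize (Hf (conj Hy (Rlt_le _ _ Hy0))).
  replace (3 * N * Cmod (p - q) / (2 * rho)) with (3 * N * y0) by (unfold y0; field; lra).
  nra.
Qed.

(** Minimum principle on an annulus, against the harmonic function that is [h] on the
    inner and 0 on the outer circle; the term with [eps] absorbs the Laplacian of [w]. *)
Lemma log_barrier (w : C -> R) (c : C) (r1 r2 h eps : R) :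
  0 < r1 < r2 -> 0 <= h -> 0 < eps ->
  (forall z, r1 <= Cmod (z - c) <= r2 ->
     0 <= w z /\ exists L, has_lap w z L /\ Rabs L <= eps) ->
  (forall z, Cmod (z - c) = r1 -> h <= w z) ->
  forall z, r1 <= Cmod (z - c) <= r2 ->
    h * ln (r2 / Cmod (z - c)) / ln (r2 / r1) - eps * (r2 * r2) / 2 <= w z.
Proof.
  intros Hr Hh Heps Hw Hin z0 Hz0.
  assert (Hl : 0 < ln (r2 / r1)).
  { rewrite <- ln_1. apply ln_increasing; [lra|].
    apply Rmult_lt_reg_r with r1; [lra|]. unfold Rdiv. rewrite Rmult_assoc, Rinv_l; lra. }
  set (k := h / ln (r2 / r1)).
  assert (Hk : 0 <= k) by (apply Rmult_le_pos; [lra|left; now apply Rinv_0_lt_compat]).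
  set (f := fun z => k * tau z + eps / 2 * sqnorm z +
      (k * ln r2 - eps / 2 * (r2 * r2)) - w (c + 1 * z)%C).
  assert (Hsh : forall z, (c + 1 * z - c = z)%C) by (intros; ring).
  assert (Hf : forall z, r1 <= Cmod z <= r2 -> f z <= 0).
  { apply max_principle_annulus. intros z Hz.
    destruct (Hw (c + 1 * z)%C) as [W (L & HL & B)]; [now rewrite Hsh|].
    apply has_lap_similarity in HL. rewrite Cmod_1 in HL.
    exists (k * 0 + eps / 2 * 4 + 0 - (1 * 1 * L)). split.
    { apply has_lap_minus; [|exact HL].
      apply has_lap_plus; [|apply has_lap_const].
      apply has_lap_plus; apply has_lap_scal; [apply has_lap_tau; lra|apply has_lap_sqnorm]. }
    intros Hpos. unfold f in Hpos. apply Rabs_le_between in B. rewrite sqnorm_Cmod in Hpos.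
    unfold tau in Hpos.
    split; [|lra]. split; apply Rnot_le_lt; intros H.
    - assert (E : Cmod z = r1) by lra. rewrite E in Hpos.
      specialize (Hin (c + 1 * z)%C). rewrite Hsh in Hin. specialize (Hin E).
      assert (k * (ln r2 - ln r1) = h).
      { rewrite <- ln_div by lra. unfold k. field. lra. }
      assert (eps / 2 * (r1 * r1) <= eps / 2 * (r2 * r2)) by (apply Rmult_le_compat_l; nra).
      lra.
    - assert (E : Cmod z = r2) by lra. rewrite E in Hpos. lra. }
  specialize (Hf (z0 - c)%C Hz0). unfold f in Hf.
  replace (c + 1 * (z0 - c))%C with z0 in Hf by ring.
  rewrite ln_div by lra.
  unfold tau in Hf. rewrite sqnorm_Cmod in Hf.
  replace (h * (ln r2 - ln (Cmod (z0 - c))) / ln (r2 / r1))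
    with (k * (ln r2 - ln (Cmod (z0 - c)))) by (unfold k; field; lra).
  assert (0 <= eps / 2 * (Cmod (z0 - c) * Cmod (z0 - c))) by (apply Rmult_le_pos; nra).
  lra.
Qed.

Lemma ln_le_id x : 0 < x -> ln x <= x.
Proof.
  intros H. destruct (exp_ineq1_le (ln x)) as [K|K]; rewrite exp_ln in K by exact H; lra.
Qed.

(** At a maximum point [z0] of [w z * d z], [d z = 1 - |z|], the weight keeps [w] below
    [2 * w z0] on a disc of radius [d z0 / 2], hence above [w z0 / 2] on one of radius
    [d z0 / 24]. The logarithmic barrier carries this to the centre with the loss of a
    factor [ln (72 / d z0)], which is at most [72 / d z0] and so is paid for by the
    weight. *)
Lemma harnack_unit (w : C -> R) (eps : R) :
  0 < eps ->
  (forall z, Cmod z <= 4 -> 0 <= w z /\ exists L, has_lap w z L /\ Rabs L <= eps) ->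
  forall z, Cmod z <= 1 / 2 -> w z <= 288 * (w (RtoC 0) + 5 * eps).
Proof.
  intros Heps Hw z Hz.
  assert (W0 : 0 <= w (RtoC 0)) by (apply Hw; rewrite Cmod_0; lra).
  destruct (compact_max (fun z => Cmod z <= 1) 1 (fun z => w z * (1 - Cmod z)))
    as (z0 & Hz0 & Hmax).
  { intros x Hx. now apply Cmod_bounds. }
  { apply closed_Cmod_le. }
  { exists (RtoC 0). rewrite Cmod_0. lra. }
  { intros x Hx. apply (continuous_mult w (fun z => 1 - Cmod z)).
    - destruct (Hw x) as [_ (L & HL & _)]; [lra|]. now apply has_lap_continuous with L.
    - apply (continuous_minus (fun _ => 1) Cmod); [apply continuous_const|apply continuous_Cmod]. }
  cbv beta in Hmax.
  set (N := w z0) in *. set (d := 1 - Cmod z0) in *.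
  assert (HN : 0 <= N) by (apply Hw; lra).
  assert (Hd0 : 0 <= d) by (unfold d; lra).
  assert (Hd1 : d <= 1) by (unfold d; pose proof (Cmod_ge_0 z0); lra).
  assert (Hwz : 0 <= w z) by (apply Hw; lra).
  assert (Goal1 : w z <= 2 * (N * d)).
  { specialize (Hmax z ltac:(lra)). nra. }
  (* for N <= eps the bound is immediate, and N > eps lets the barrier of
     [bisector_estimate] absorb the Laplacian *)
  destruct (Rle_lt_dec N eps) as [HNe|HNe]; [nra|].
  destruct (Rle_lt_or_eq_dec 0 d Hd0) as [Hd|Hd]; [|rewrite <- Hd in *; nra].
  assert (Hnear : forall x, Cmod (x - z0) <= d / 2 -> 0 <= w x <= 2 * N).
  { intros x Hx. assert (Hx' : Cmod x <= Cmod z0 + d / 2).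
    { replace x with (z0 + (x - z0))%C by ring.
      eapply Rle_trans; [apply Cmod_triangle|]. lra. }
    assert (Cmod x <= 1 - d / 2) by (unfold d in *; lra).
    split; [apply Hw; lra|].
    specialize (Hmax x ltac:(lra)).
    assert (0 <= w x) by (apply Hw; lra).
    apply Rmult_le_reg_r with (d / 2); [lra|]. nra. }
  assert (Hring : forall x, Cmod (x - z0) <= d / 24 -> N / 2 <= w x).
  { intros x Hx.
    destruct (Ceq_dec x z0) as [->|Hne]; [fold N; lra|].
    assert (Hx' : Cmod (z0 - x) = Cmod (x - z0)).
    { rewrite <- Cmod_opp. f_equal. ring. }
    pose proof (bisector_estimate w z0 x (d / 4) (2 * N) eps) as Hb.
    assert (w z0 - w x <= 3 * (2 * N) * Cmod (z0 - x) / (2 * (d / 4))).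
    { apply Hb.
      - lra.
      - intros E. now apply Hne.
      - lra.
      - nra.
      - intros y Hy.
        assert (Hy' : Cmod (y - z0) <= d / 2).
        { replace (y - z0)%C with ((y - (z0 + x) / 2) + (x - z0) / 2)%C by (field; 
            intros E; apply RtoC_inj in E; lra).
          eapply Rle_trans; [apply Cmod_triangle|].
          rewrite Cmod_div by (intros E; apply RtoC_inj in E; lra).
          rewrite Cmod_R, (Rabs_pos_eq 2) by lra. lra. }
        split; [now apply Hnear|].
        apply Hw. replace y with (z0 + (y - z0))%C by ring.
        eapply Rle_trans; [apply Cmod_triangle|]. lra. }
    rewrite Hx' in H. fold N in H.
    apply Rle_trans with (N - 3 * (2 * N) * (d / 24) / (2 * (d / 4))).
    { right. field. lra. }
    assert (3 * (2 * N) * Cmod (x - z0) / (2 * (d / 4)) <= 3 * (2 * N) * (d / 24) / (2 * (d / 4)));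
      [|lra].
    apply Rmult_le_compat_r; [left; apply Rinv_0_lt_compat; lra|nra]. }
  assert (Hl : 1 <= ln 3).
  { rewrite <- (ln_exp 1) at 1. apply ln_le; [apply exp_pos|]. exact exp_le_3. }
  assert (H0z : Cmod (RtoC 0 - z0) = Cmod z0).
  { rewrite <- Cmod_opp. f_equal. ring. }
  destruct (Rle_lt_dec (Cmod z0) (d / 24)) as [Hc|Hc].
  { specialize (Hring (RtoC 0)). rewrite H0z in Hring. specialize (Hring Hc). nra. }
  pose proof (log_barrier w z0 (d / 24) 3 (N / 2) eps) as Hb.
  specialize (Hb ltac:(lra) ltac:(lra) Heps).
  assert (Hb' := Hb ltac:(intros x Hx; apply Hw; replace x with (z0 + (x - z0))%C by ring;
    eapply Rle_trans; [apply Cmod_triangle|]; lra)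
    ltac:(intros x Hx; apply Hring; lra) (RtoC 0)). clear Hb.
  rewrite H0z in Hb'. specialize (Hb' ltac:(lra)).
  assert (L1 : 1 <= ln (3 / Cmod z0)).
  { eapply Rle_trans; [exact Hl|]. apply ln_le; [lra|].
    apply Rmult_le_reg_r with (Cmod z0); [lra|]. unfold Rdiv. rewrite Rmult_assoc, Rinv_l; lra. }
  assert (L2 : ln (3 / (d / 24)) <= 72 / d).
  { replace (3 / (d / 24)) with (72 / d) by (field; lra). apply ln_le_id.
    apply Rdiv_lt_0_compat; lra. }
  assert (L3 : 0 < ln (3 / (d / 24))).
  { rewrite <- ln_1. apply ln_increasing; [lra|].
    apply Rmult_lt_reg_r with (d / 24); [lra|].
    replace (3 / (d / 24) * (d / 24)) with 3 by (field; lra). lra. }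
  assert (L4 : N * d / 144 <= N / 2 * ln (3 / Cmod z0) / ln (3 / (d / 24))).
  { apply Rmult_le_reg_r with (ln (3 / (d / 24))); [exact L3|].
    replace (N / 2 * ln (3 / Cmod z0) / ln (3 / (d / 24)) * ln (3 / (d / 24)))
      with (N / 2 * ln (3 / Cmod z0)) by (field; lra).
    apply Rle_trans with (N * d / 144 * (72 / d)).
    - apply Rmult_le_compat_l; [|exact L2]. nra.
    - replace (N * d / 144 * (72 / d)) with (N / 2) by (field; lra). nra. }
  lra.
Qed.

Lemma harnack_disc (w : C -> R) (c : C) (s eps : R) :
  0 < s -> 0 < eps ->
  (forall z, Cmod (z - c) <= 4 * s ->
     0 <= w z /\ exists L, has_lap w z L /\ Rabs L <= eps / (s * s)) ->
  forall z, Cmod (z - c) <= s / 2 -> w z <= 288 * (w c + 5 * eps).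
Proof.
  intros Hs Heps Hw z Hz.
  assert (Hsc : RtoC s <> 0%C) by (intros E; apply RtoC_inj in E; lra).
  assert (Hcs : Cmod s = s) by (rewrite Cmod_R, Rabs_pos_eq; lra).
  pose proof (harnack_unit (fun x => w (c + s * x)%C) eps Heps) as H.
  cbv beta in H.
  replace (c + s * RtoC 0)%C with c in H by ring.
  replace z with (c + s * ((z - c) / s))%C by (field; exact Hsc).
  apply H.
  - intros x Hx. destruct (Hw (c + s * x)%C) as [W (L & HL & B)].
    + replace (c + s * x - c)%C with (s * x)%C by ring.
      rewrite Cmod_mult, Hcs. nra.
    + split; [exact W|]. apply has_lap_similarity in HL.
      exists (Cmod s * Cmod s * L). split; [exact HL|].
      rewrite Hcs, Rabs_mult, Rabs_pos_eq by nra.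
      apply Rle_trans with (s * s * (eps / (s * s))).
      * apply Rmult_le_compat_l; [nra|exact B].
      * right. field. lra.
  - rewrite Cmod_div, Hcs by exact Hsc.
    apply Rmult_le_reg_r with s; [exact Hs|].
    replace (Cmod (z - c) / s * s) with (Cmod (z - c)) by (field; lra). lra.
Qed.

(** * Chains of discs around a circle *)

Definition polar (r a : R) : C := (r * cos a, r * sin a).

Lemma Cmod_polar r a : 0 <= r -> Cmod (polar r a) = r.
Proof.
  intros Hr. unfold Cmod, polar. cbn [fst snd].
  replace ((r * cos a) ^ 2 + (r * sin a) ^ 2) with (Rsqr r * (Rsqr (sin a) + Rsqr (cos a)))
    by (unfold Rsqr; ring).
  rewrite sin2_cos2, Rmult_1_r. now apply sqrt_Rsqr.
Qed.

Lemma Rabs_sin_le x : Rabs (sin x) <= Rabs x.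
Proof.
  assert (P : forall y, 0 <= y -> Rabs (sin y) <= y).
  { intros y Hy. apply Rabs_le_between. split.
    - destruct (Rle_lt_dec y 1) as [H|H].
      + assert (0 <= sin y); [|lra]. apply sin_ge_0; [exact Hy|].
        pose proof PI2_1. lra.
      + pose proof (SIN_bound y). lra.
    - destruct Hy as [Hy|<-]; [left; now apply sin_lt_x|rewrite sin_0; lra]. }
  destruct (Rle_lt_dec 0 x) as [H|H].
  - rewrite (Rabs_pos_eq x) by exact H. now apply P.
  - rewrite (Rabs_left x) by exact H. rewrite <- Rabs_Ropp, <- sin_neg. apply P. lra.
Qed.

Lemma polar_chord r a b : 0 <= r -> Cmod (polar r a - polar r b) <= r * Rabs (a - b).
Proof.
  intros Hr. unfold Cmod, polar. cbn [fst snd Cminus Cplus Copp].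
  rewrite <- (sqrt_Rsqr (r * Rabs (a - b))) by (apply Rmult_le_pos; [exact Hr|apply Rabs_pos]).
  apply sqrt_le_1_alt. rewrite Rsqr_mult, <- Rsqr_abs.
  replace ((r * cos a + - (r * cos b)) ^ 2 + (r * sin a + - (r * sin b)) ^ 2)
    with (Rsqr r * ((Rsqr (sin a) + Rsqr (cos a)) + (Rsqr (sin b) + Rsqr (cos b))
            - 2 * (cos a * cos b + sin a * sin b))) by (unfold Rsqr; ring).
  rewrite !sin2_cos2, <- cos_minus.
  apply Rmult_le_compat_l; [apply Rle_0_sqr|].
  set (x := a - b). replace x with (2 * (x / 2)) at 1 by field.
  rewrite cos_2a_sin.
  pose proof (Rabs_sin_le (x / 2)) as H. apply Rsqr_le_abs_1 in H. unfold Rsqr in *. lra.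
Qed.

Lemma polar_exists z : 0 < Cmod z -> exists a, Rabs a <= 4 /\ z = polar (Cmod z) a.
Proof.
  intros Hr. set (r := Cmod z) in *.
  assert (Sq : Re z * Re z + Im z * Im z = r * r) by apply sqnorm_Cmod.
  destruct (Cmod_bounds z r (Rle_refl _)) as [Hx _].
  apply Rabs_le_between in Hx.
  set (c := Re z / r).
  assert (Hc : r * c = Re z) by (unfold c; field; lra).
  assert (Hc1 : -1 <= c <= 1) by nra.
  pose proof (acos_bound c) as Ha. pose proof PI_4 as HPI.
  assert (Hs : r * sqrt (1 - Rsqr c) = Rabs (Im z)).
  { rewrite <- (sqrt_Rsqr r) at 1 by lra. rewrite <- sqrt_mult_alt by apply Rle_0_sqr.
    rewrite <- sqrt_Rsqr_abs. f_equal. unfold Rsqr.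
    replace (r * r * (1 - c * c)) with (r * r - (r * c) * (r * c)) by ring. rewrite Hc. lra. }
  destruct (Rle_lt_dec 0 (Im z)) as [H|H].
  - exists (acos c). split; [rewrite Rabs_pos_eq; lra|].
    unfold polar. rewrite cos_acos, sin_acos, Hc, Hs by exact Hc1.
    rewrite Rabs_pos_eq by exact H. symmetry. apply C_eta.
  - exists (- acos c). split; [rewrite Rabs_Ropp, Rabs_pos_eq; lra|].
    unfold polar. rewrite cos_neg, sin_neg, cos_acos, sin_acos, Hc by exact Hc1.
    replace (r * - sqrt (1 - Rsqr c)) with (- (r * sqrt (1 - Rsqr c))) by ring.
    rewrite Hs, Rabs_left, Ropp_involutive by exact H. symmetry. apply C_eta.
Qed.

Definition nearly_harmonic_near_circle (w : C -> R) (r eps : R) : Prop :=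
  forall z, 3 / 4 * r <= Cmod z <= 5 / 4 * r ->
    0 <= w z /\ exists L, has_lap w z L /\ Rabs L <= eps / (r * r).

(** Small steps: on a circle of radius [r], an angle [1 / 32] keeps within the half
    radius of the disc used by [harnack_disc] with [s = r / 16]. *)
Lemma harnack_chain (n : nat) : exists K, 0 < K /\
  forall w r eps, 0 < r -> 0 < eps -> nearly_harmonic_near_circle w r eps ->
  forall a b, Rabs (b - a) <= INR n / 32 ->
    w (polar r b) <= K * (w (polar r a) + eps).
Proof.
  induction n as [|n [K [HK IH]]].
  - exists 1. split; [lra|]. intros w r eps Hr Heps _ a b Hab.
    cbn in Hab. replace b with a; [lra|].
    assert (Rabs (b - a) <= 0) by lra.
    apply Rabs_le_between in H. lra.
  - exists (288 * (K + 5)). split; [lra|].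
    intros w r eps Hr Heps Hw a b Hab.
    rewrite S_INR in Hab. pose proof (pos_INR n) as Hn.
    set (b' := a + (b - a) * (INR n / (INR n + 1))).
    assert (H1 : Rabs (b' - a) <= INR n / 32).
    { replace (b' - a) with ((b - a) * (INR n / (INR n + 1))) by (unfold b'; ring).
      rewrite Rabs_mult, (Rabs_pos_eq (INR n / _)).
      2: { apply Rmult_le_pos; [exact Hn|]. left. apply Rinv_0_lt_compat. lra. }
      apply Rle_trans with ((INR n + 1) / 32 * (INR n / (INR n + 1))).
      - apply Rmult_le_compat_r; [|exact Hab].
        apply Rmult_le_pos; [exact Hn|]. left. apply Rinv_0_lt_compat. lra.
      - right. field. lra. }
    assert (H2 : Rabs (b - b') <= / 32).
    { replace (b - b') with ((b - a) * / (INR n + 1)) by (unfold b'; field; lra).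
      rewrite Rabs_mult, (Rabs_pos_eq (/ _)) by (left; apply Rinv_0_lt_compat; lra).
      apply Rle_trans with ((INR n + 1) / 32 * / (INR n + 1)).
      - apply Rmult_le_compat_r; [left; apply Rinv_0_lt_compat; lra|exact Hab].
      - right. field. lra. }
    specialize (IH w r eps Hr Heps Hw a b' H1).
    assert (H3 : w (polar r b) <= 288 * (w (polar r b') + 5 * eps)).
    { apply (harnack_disc w (polar r b') (r / 16) eps); [lra|exact Heps| |].
      - intros z Hz. pose proof (Cmod_polar r b' (Rlt_le _ _ Hr)) as Hp.
        assert (U : Cmod z <= r + r / 4).
        { replace z with (polar r b' + (z - polar r b'))%C by ring.
          eapply Rle_trans; [apply Cmod_triangle|]. lra. }
        assert (V : r <= Cmod z + r / 4).
        { rewrite <- Hp at 1. replace (polar r b') with (z + - (z - polar r b'))%C by ring.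
          eapply Rle_trans; [apply Cmod_triangle|]. rewrite Cmod_opp. lra. }
        destruct (Hw z) as [W (L & HL & B)]; [lra|].
        split; [exact W|]. exists L. split; [exact HL|].
        eapply Rle_trans; [exact B|].
        replace (eps / (r / 16 * (r / 16))) with (256 * (eps / (r * r))) by (field; lra).
        assert (0 < eps / (r * r)) by (apply Rdiv_lt_0_compat; nra). lra.
      - eapply Rle_trans; [apply polar_chord; lra|]. nra. }
    assert (0 <= w (polar r a)).
    { apply Hw. rewrite Cmod_polar; lra. }
    nra.
Qed.

(** Arguments can be taken in [[-4, 4]], so two of them differ by at most
    [8 = 256 / 32]. *)
Lemma harnack_circle : exists K, 0 < K /\
  forall w r eps, 0 < r -> 0 < eps -> nearly_harmonic_near_circle w r eps ->
  forall z1 z2, Cmod z1 = r -> Cmod z2 = r -> w z2 <= K * (w z1 + eps).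
Proof.
  destruct (harnack_chain 256) as [K [HK H]]. exists K. split; [exact HK|].
  intros w r eps Hr Heps Hw z1 z2 H1 H2.
  destruct (polar_exists z1) as [a [Ha E1]]; [lra|].
  destruct (polar_exists z2) as [b [Hb E2]]; [lra|].
  rewrite E1, E2, H1, H2. apply (H w r eps Hr Heps Hw).
  replace (INR 256 / 32) with 8 by (rewrite INR_IZR_INZ; cbn; field).
  eapply Rle_trans; [apply Rabs_triang|]. rewrite Rabs_Ropp. lra.
Qed.

(** * Upper bound by the hyperbolic metric *)

(** All that is kept of the equation: the curvature lies between [-a] and [-A] near
    the puncture, namely on the punctured disc of radius [exp (- T0)]. *)
Definition pinched (u : C -> R) (A a T0 : R) : Prop :=
  forall z, 0 < Cmod z -> T0 < tau z ->
    exists L, has_lap u z L /\ A * exp (2 * u z) <= L <= a * exp (2 * u z).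

Lemma annulus_tau t1 t2 z :
  exp (- t2) <= Cmod z <= exp (- t1) -> 0 < Cmod z /\ t1 <= tau z <= t2.
Proof.
  intros [H1 H2]. pose proof (exp_pos (- t2)).
  assert (H0 : 0 < Cmod z) by lra.
  split; [exact H0|]. split; [now apply tau_le_iff|now apply tau_ge_iff].
Qed.

Lemma tau_annulus t1 t2 z :
  0 < Cmod z -> t1 <= tau z <= t2 -> exp (- t2) <= Cmod z <= exp (- t1).
Proof.
  intros H0 [H1 H2]. split; [now apply tau_ge_iff|now apply tau_le_iff].
Qed.

Lemma max_principle_tau t1 t2 (f : C -> R) :
  (forall z, 0 < Cmod z -> t1 <= tau z <= t2 -> exists L, has_lap f z L /\
     (0 < f z -> t1 < tau z < t2 /\ 0 < L)) ->
  forall z, 0 < Cmod z -> t1 <= tau z <= t2 -> f z <= 0.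
Proof.
  intros H z Hz Ht. apply (max_principle_annulus (exp (- t2)) (exp (- t1))).
  - intros w Hw. destruct (annulus_tau _ _ _ Hw) as [W1 W2].
    destruct (H w W1 W2) as [L [HL H']]. exists L. split; [exact HL|].
    intros Hf. destruct (H' Hf) as [Hs HL']. split; [|exact HL'].
    rewrite <- (exp_tau w W1). split; apply exp_increasing; lra.
  - now apply tau_annulus.
Qed.

(** The supersolution [t - ln x - ln (l - x) + const], [x = t - T1], is infinite on both
    ends of the annulus [0 < x < l], so it dominates [u] there, and by the maximum
    principle everywhere: where it is exceeded by [u], the nonlinearity makes the
    difference subharmonic. Evaluating in the middle of the annulus, [l] being twice
    the depth of [z], gives the bound. *)
Lemma ahlfors_bound (u : C -> R) (A a T0 T1 : R) :
  0 < A -> pinched u A a T0 -> T0 < T1 ->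
  forall z, 0 < Cmod z -> T1 < tau z ->
    u z <= tau z - ln (tau z - T1) + (ln 2 - ln A / 2).
Proof.
  intros HA Hu HT z Hz Htz.
  set (h := tau z - T1). assert (Hh : 0 < h) by (unfold h; lra).
  set (l := 2 * h).
  destruct (compact_max (fun w => exp (- (T1 + l)) <= Cmod w <= exp (- T1)) (exp (- T1)) u)
    as (w0 & _ & Hmax).
  { intros w [_ Hw]. now apply Cmod_bounds. }
  { apply closed_annulus. }
  { exists z. apply tau_annulus; [exact Hz|]. unfold l, h in *. lra. }
  { intros w Hw. apply annulus_tau in Hw. destruct Hw as [W1 W2].
    destruct (Hu w W1) as (L & HL & _); [lra|]. now apply has_lap_continuous with L. }
  set (M := u w0) in *.
  (* width of the collars in which the barrier exceeds [M], making it a valid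
     comparison function on a compact annulus *)
  set (d := Rmin (h / 2) (exp (T1 - ln A / 2 - M))).
  assert (Hd : 0 < d) by (apply Rmin_pos; [lra|apply exp_pos]).
  assert (Hdh : d <= h / 2) by apply Rmin_l.
  assert (Hlnd : ln d <= T1 - ln A / 2 - M).
  { rewrite <- (ln_exp (T1 - ln A / 2 - M)). apply ln_le; [exact Hd|apply Rmin_r]. }
  set (phi := fun t => t - ln (t - T1) - ln (l - (t - T1)) + (ln l - ln A / 2)).
  set (psi := fun t => 1 - 1 / (t - T1) + 1 / (l - (t - T1))).
  set (sec := fun t => 1 / ((t - T1) * (t - T1)) + 1 / ((l - (t - T1)) * (l - (t - T1)))).
  assert (Hlap : forall w, 0 < Cmod w -> T1 + d <= tau w <= T1 + l - d ->
     has_lap (fun w => phi (tau w)) w (sec (tau w) * exp (2 * tau w))).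
  { intros w W1 W2. apply (has_lap_radial phi psi _ d w W1 Hd).
    - intros t Ht. apply Rabs_lt_between in Ht. unfold phi, psi.
      auto_derive; [repeat split; lra|]. field. split; lra.
    - unfold psi, sec. auto_derive; [repeat split; lra|]. field. split; lra. }
  assert (Hf : forall w, 0 < Cmod w -> T1 + d <= tau w <= T1 + l - d ->
     u w - phi (tau w) <= 0).
  { apply max_principle_tau. intros w W1 W2.
    destruct (Hu w W1) as (L & HL & B1 & B2); [lra|].
    exists (L - sec (tau w) * exp (2 * tau w)). split.
    { apply has_lap_minus; [exact HL|now apply Hlap]. }
    intros Hpos.
    assert (Hb : u w <= M).
    { apply Hmax. apply tau_annulus; [exact W1|]. lra. }
    set (x := tau w - T1) in *.
    assert (X1 : d <= x) by (unfold x; lra).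
    assert (X2 : d <= l - x) by (unfold x; lra).
    split.
    - assert (Hend : forall y y', y = d -> y' <= l -> 0 < y' ->
        M <= tau w - ln y - ln y' + (ln l - ln A / 2)).
      { intros y y' -> Hy' Hy0. assert (ln y' <= ln l) by (now apply ln_le). lra. }
      unfold phi in Hpos. fold x in Hpos.
      split; apply Rnot_le_lt; intros H.
      + specialize (Hend x (l - x)).
        assert (x = d) by (unfold x in *; lra). specialize (Hend H0 ltac:(lra) ltac:(lra)). lra.
      + specialize (Hend (l - x) x).
        assert (l - x = d) by (unfold x in *; lra). specialize (Hend H0 ltac:(lra) ltac:(lra)). lra.
    - assert (E : A * exp (2 * phi (tau w))
          = (l * l) / ((x * x) * ((l - x) * (l - x))) * exp (2 * tau w)).
      { unfold phi. fold x.
        replace (2 * (tau w - ln x - ln (l - x) + (ln l - ln A / 2)))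
          with (2 * tau w + (ln l + ln l) + - ((ln x + ln x) + (ln (l - x) + ln (l - x))) + - ln A)
          by field.
        rewrite !exp_plus, !exp_Ropp, !exp_plus, !exp_ln by lra. field. lra. }
      assert (S : sec (tau w) <= (l * l) / ((x * x) * ((l - x) * (l - x)))).
      { unfold sec. fold x.
        apply Rmult_le_reg_r with ((x * x) * ((l - x) * (l - x))).
        { repeat apply Rmult_lt_0_compat; lra. }
        replace (l * l / (x * x * ((l - x) * (l - x))) * (x * x * ((l - x) * (l - x))))
          with (l * l) by (field; lra).
        replace ((1 / (x * x) + 1 / ((l - x) * (l - x))) * (x * x * ((l - x) * (l - x))))
          with ((l - x) * (l - x) + x * x) by (field; lra). nra. }
      assert (S' : sec (tau w) * exp (2 * tau w) <= A * exp (2 * phi (tau w))).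
      { rewrite E. apply Rmult_le_compat_r; [left; apply exp_pos|exact S]. }
      assert (exp (2 * phi (tau w)) < exp (2 * u w)) by (apply exp_increasing; lra).
      assert (A * exp (2 * phi (tau w)) < A * exp (2 * u w)) by (now apply Rmult_lt_compat_l).
      lra. }
  specialize (Hf z Hz). unfold phi in Hf. fold h in Hf.
  replace (l - h) with h in Hf by (unfold l; ring).
  assert (Hl : ln l = ln 2 + ln h) by (unfold l; apply ln_mult; lra).
  rewrite Hl in Hf.
  assert (T1 + d <= tau z <= T1 + l - d) by (unfold l, h in *; lra).
  specialize (Hf H). lra.
Qed.

(** * Growth of circle maxima *)

Definition convex_beyond (T0 : R) (m : R -> R) : Prop :=
  forall t1 t t2, T0 < t1 -> t1 < t -> t < t2 ->
    (m t - m t1) * (t2 - t1) <= (m t2 - m t1) * (t - t1).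

(** Both halves are uniform in the interval, which is more than [m t / t -> alpha]:
    they also give [m (t + 1) - m t -> alpha]. *)
Definition asymptotic_slope (T0 : R) (m : R -> R) (alpha : R) : Prop :=
  (forall s t, T0 < s -> s <= t -> m t - m s <= alpha * (t - s)) /\
  (forall eps, 0 < eps -> exists s0, T0 < s0 /\
     forall s t, s0 <= s -> s <= t -> (alpha - eps) * (t - s) <= m t - m s).

(** [alpha] is the supremum of the difference quotients of [m]. These increase in both
    arguments, so a slope above 1 would persist and contradict the upper bound, and
    a slope close to [alpha] is only improved upon further out. *)
Lemma convex_slope (T0 C : R) (m : R -> R) :
  convex_beyond T0 m -> (forall t, T0 < t -> m t <= t + C) ->
  exists alpha, alpha <= 1 /\ asymptotic_slope T0 m alpha.
Proof.
  intros Hc Hb.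
  set (E := fun y => exists s t, T0 < s /\ s < t /\ y = (m t - m s) / (t - s)).
  assert (HE : forall y, E y -> y <= 1).
  { intros y (s & t & Hs & Hst & ->).
    apply Rnot_lt_le. intros H.
    set (k := (m t - m s) / (t - s)) in *.
    assert (Hk : m t - m s = k * (t - s)) by (unfold k; field; lra).
    set (D := Rabs (C + s - m s) + 1).
    pose proof (Rle_abs (C + s - m s)) as Habs. pose proof (Rabs_pos (C + s - m s)) as Hab0.
    assert (HD : 0 < D / (k - 1)) by (apply Rdiv_lt_0_compat; unfold D; lra).
    set (t2 := t + D / (k - 1)).
    specialize (Hc s t t2 Hs Hst ltac:(unfold t2; lra)).
    specialize (Hb t2 ltac:(unfold t2; lra)).
    rewrite Hk in Hc.
    assert (k * (t2 - s) <= m t2 - m s).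
    { apply Rmult_le_reg_r with (t - s); lra. }
    assert ((k - 1) * (D / (k - 1)) = D) by (field; lra).
    assert ((k - 1) * (t2 - s) = (k - 1) * (t - s) + D) by (unfold t2; lra).
    assert (0 <= (k - 1) * (t - s)) by (apply Rmult_le_pos; lra).
    unfold D in *. lra. }
  destruct (completeness E) as [alpha [Ha1 Ha2]].
  { exists 1. exact HE. }
  { exists ((m (T0 + 2) - m (T0 + 1)) / (T0 + 2 - (T0 + 1))), (T0 + 1), (T0 + 2).
    repeat split; lra. }
  exists alpha. split; [now apply Ha2|]. split.
  - intros s t Hs [Hst|<-]; [|lra].
    assert (H : (m t - m s) / (t - s) <= alpha) by (apply Ha1; now exists s, t).
    apply Rmult_le_compat_r with (r := t - s) in H; [|lra].
    replace ((m t - m s) / (t - s) * (t - s)) with (m t - m s) in H by (field; lra). lra.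
  - intros eps Heps.
    assert (HN : exists y, E y /\ alpha - eps < y).
    { apply NNPP. intros HN. assert (alpha <= alpha - eps); [|lra].
      apply Ha2. intros y Hy. apply Rnot_lt_le. intros H. apply HN. now exists y. }
    destruct HN as (y & (s1 & t1 & Hs1 & Hst1 & ->) & Hy).
    set (k := (m t1 - m s1) / (t1 - s1)) in *.
    assert (Hk : m t1 - m s1 = k * (t1 - s1)) by (unfold k; field; lra).
    exists t1. split; [lra|]. intros s t Hs [Hst|<-]; [|lra].
    assert (K1 : k * (s - s1) <= m s - m s1).
    { destruct Hs as [Hs|<-]; [|lra].
      specialize (Hc s1 t1 s Hs1 Hst1 Hs). rewrite Hk in Hc.
      apply Rmult_le_reg_r with (t1 - s1); lra. }
    specialize (Hc s1 s t Hs1 ltac:(lra) Hst).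
    assert (K2 : k * (t - s) <= m t - m s).
    { apply Rmult_le_reg_r with (s - s1); [lra|].
      apply Rmult_le_compat_r with (r := t - s) in K1; [|lra]. nra. }
    eapply Rle_trans; [|exact K2]. apply Rmult_le_compat_r; lra.
Qed.

Definition circle_max (u : C -> R) (t : R) : R := circle_sup u (exp (- t)).

Lemma circle_max_spec (u : C -> R) (A a T0 : R) t :
  pinched u A a T0 -> T0 < t ->
  (forall z, 0 < Cmod z -> tau z = t -> u z <= circle_max u t) /\
  exists z, 0 < Cmod z /\ tau z = t /\ u z = circle_max u t.
Proof.
  intros Hu Ht. pose proof (exp_pos (- t)) as He.
  destruct (circle_sup_max u (exp (- t))) as [H1 (z & Hz & H2)].
  - lra.
  - intros z Hz. destruct (Hu z) as (L & HL & _); [lra| |now apply has_lap_continuous with L].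
    rewrite (tau_eq z t Hz). exact Ht.
  - split.
    + intros w Hw Hwt. apply H1. rewrite <- Hwt. symmetry. now apply exp_tau.
    + exists z. split; [lra|]. split; [now apply tau_eq|exact H2].
Qed.

(** Three circles: [u] minus an affine function of [tau] is strictly subharmonic. *)
Lemma circle_max_convex (u : C -> R) (A a T0 : R) :
  0 < A -> pinched u A a T0 -> convex_beyond T0 (circle_max u).
Proof.
  intros HA Hu t1 t t2 H1 H2 H3.
  set (m := circle_max u).
  set (k := (m t2 - m t1) / (t2 - t1)).
  assert (Hk : k * (t2 - t1) = m t2 - m t1) by (unfold k; field; lra).
  assert (Hf : forall z, 0 < Cmod z -> t1 <= tau z <= t2 ->
     u z - (k * tau z + (m t1 - k * t1)) <= 0).
  { apply max_principle_tau. intros z Hz Hzt.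
    destruct (Hu z Hz) as (L & HL & B1 & _); [lra|].
    exists (L - (k * 0 + 0)). split.
    { apply has_lap_minus; [exact HL|].
      apply has_lap_plus; [apply has_lap_scal; now apply has_lap_tau|apply has_lap_const]. }
    intros Hpos. split.
    - split; apply Rnot_le_lt; intros H.
      + assert (E : tau z = t1) by lra.
        destruct (circle_max_spec u A a T0 t1 Hu H1) as [Hm _].
        specialize (Hm z Hz E). fold m in Hm. rewrite E in Hpos. lra.
      + assert (E : tau z = t2) by lra.
        destruct (circle_max_spec u A a T0 t2 Hu ltac:(lra)) as [Hm _].
        specialize (Hm z Hz E). fold m in Hm. rewrite E in Hpos. lra.
    - pose proof (exp_pos (2 * u z)). assert (0 < A * exp (2 * u z)) by nra. lra. }
  destruct (circle_max_spec u A a T0 t Hu ltac:(lra)) as [_ (z & Hz & E & Em)].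
  specialize (Hf z Hz ltac:(lra)). rewrite Em, E in Hf. fold m in Hf.
  rewrite <- Hk.
  replace (k * (t2 - t1) * (t - t1)) with (k * (t - t1) * (t2 - t1)) by ring.
  apply Rmult_le_compat_r; lra.
Qed.

Lemma asymptotic_slope_limit T0 m alpha eps :
  asymptotic_slope T0 m alpha -> 0 < eps ->
  exists t0, 0 < t0 /\ forall t, t0 < t -> Rabs (m t / t - alpha) < eps.
Proof.
  intros [H1 H2] Heps.
  destruct (H2 (eps / 2)) as (s0 & Hs0 & Hl); [lra|].
  set (D := Rabs (m s0 - alpha * s0) + Rabs (eps / 2 * s0)).
  assert (HD : 0 <= D) by (apply Rplus_le_le_0_compat; apply Rabs_pos).
  exists (Rmax (Rmax s0 1) (2 * D / eps)). split.
  { eapply Rlt_le_trans; [|apply Rmax_l]. eapply Rlt_le_trans; [|apply Rmax_r]. lra. }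
  intros t Ht.
  pose proof (Rmax_l (Rmax s0 1) (2 * D / eps)). pose proof (Rmax_r (Rmax s0 1) (2 * D / eps)).
  pose proof (Rmax_l s0 1). pose proof (Rmax_r s0 1).
  assert (Hst : s0 <= t) by lra.
  specialize (H1 s0 t Hs0 Hst). specialize (Hl s0 t (Rle_refl _) Hst).
  assert (K : D < eps / 2 * t).
  { assert (2 * D / eps < t) by lra.
    apply Rmult_lt_compat_l with (r := eps / 2) in H5; [|lra].
    replace (eps / 2 * (2 * D / eps)) with D in H5 by (field; lra). exact H5. }
  pose proof (Rle_abs (m s0 - alpha * s0)) as A1.
  pose proof (Rle_abs (- (m s0 - alpha * s0))) as A2. rewrite Rabs_Ropp in A2.
  pose proof (Rle_abs (eps / 2 * s0)) as A3.
  pose proof (Rle_abs (- (eps / 2 * s0))) as A4. rewrite Rabs_Ropp in A4.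
  pose proof (Rabs_pos (m s0 - alpha * s0)). pose proof (Rabs_pos (eps / 2 * s0)).
  unfold D in K.
  replace (m t / t - alpha) with ((m t - alpha * t) / t) by (field; lra).
  apply Rabs_lt_between. split; apply Rmult_lt_reg_r with t; try lra;
    unfold Rdiv; rewrite Rmult_assoc, Rinv_l by lra; lra.
Qed.

(** Let [alpha tau + B] be the affine majorant of the circle maxima that meets them at
    [tau = t - 1], and [w] its excess over [u]. At the maximum point of [u] on the circle
    [tau = t], [w] is small because the maxima at [t - 1] and [t] differ by almost [alpha]. The upper bound
    [ahlfors_bound] makes [|z|^2 e^(2 u)] tend to 0, so that [w] is nearly harmonic and
    Harnack spreads the smallness over the whole circle. *)
Lemma oscillation_vanishes (u : C -> R) (A a T0 alpha eta : R) :
  0 < A -> 0 < a -> pinched u A a T0 ->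
  asymptotic_slope T0 (circle_max u) alpha -> 0 < eta ->
  exists t0, T0 < t0 /\ forall z, 0 < Cmod z -> t0 < tau z ->
    circle_max u (tau z) - u z <= eta.
Proof.
  intros HA Ha Hu [S1 S2] Heta.
  destruct harnack_circle as [K [HK Harnack]].
  set (m := circle_max u) in *.
  set (eps := eta / (2 * K)).
  assert (Heps : 0 < eps) by (apply Rdiv_lt_0_compat; lra).
  destruct (S2 eps Heps) as (s0 & Hs0 & Hl).
  set (Cst := ln 2 - ln A / 2).
  set (N := - ln (eps / (2 * a)) / 2).
  assert (HN : a * exp (2 * (- N)) = eps / 2).
  { unfold N. replace (2 * - (- ln (eps / (2 * a)) / 2)) with (ln (eps / (2 * a))) by field.
    rewrite exp_ln by (apply Rdiv_lt_0_compat; lra). field. lra. }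
  pose proof (exp_pos (Cst + N)) as HX.
  exists (Rmax s0 (T0 + 1 + exp (Cst + N)) + 1).
  pose proof (Rmax_l s0 (T0 + 1 + exp (Cst + N))).
  pose proof (Rmax_r s0 (T0 + 1 + exp (Cst + N))).
  split; [lra|]. intros z Hz Ht.
  set (t := tau z) in *.
  set (B := m (t - 1) - alpha * (t - 1)).
  set (w := fun x => (alpha * tau x + B) - u x).
  set (r := Cmod z) in *.
  assert (He : exp (- (t - 1)) = r * exp 1).
  { replace (- (t - 1)) with (- t + 1) by ring. rewrite exp_plus. unfold t.
    rewrite exp_tau by exact Hz. reflexivity. }
  assert (He2 : 2 <= exp 1) by (pose proof (exp_ineq1_le 1); lra).
  assert (Hw : nearly_harmonic_near_circle w r eps).
  { intros x [X1 X2]. assert (X0 : 0 < Cmod x) by lra.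
    assert (Xt : t - 1 <= tau x) by (apply tau_le_iff; [exact X0|rewrite He; nra]).
    split.
    - destruct (circle_max_spec u A a T0 (tau x) Hu ltac:(lra)) as [Hm _].
      specialize (Hm x X0 eq_refl). fold m in Hm.
      specialize (S1 (t - 1) (tau x) ltac:(lra) Xt). unfold w, B. lra.
    - destruct (Hu x X0) as (L & HL & B1 & B2); [lra|].
      exists ((alpha * 0 + 0) - L). split.
      { apply has_lap_minus; [|exact HL].
        apply has_lap_plus; [apply has_lap_scal; now apply has_lap_tau|apply has_lap_const]. }
      replace (alpha * 0 + 0 - L) with (- L) by ring. rewrite Rabs_Ropp.
      pose proof (exp_pos (2 * u x)).
      assert (0 < A * exp (2 * u x)) by nra.
      rewrite Rabs_pos_eq by lra.
      eapply Rle_trans; [exact B2|].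
      assert (Hux : u x <= tau x - N).
      { pose proof (ahlfors_bound u A a T0 (T0 + 1) HA Hu ltac:(lra) x X0 ltac:(lra)) as Hah.
        fold Cst in Hah.
        assert (Cst + N <= ln (tau x - (T0 + 1))); [|lra].
        rewrite <- (ln_exp (Cst + N)). apply ln_le; lra. }
      apply Rle_trans with (a * exp (2 * (- N) + 2 * tau x)).
      { apply Rmult_le_compat_l; [lra|]. apply exp_le_iff. lra. }
      rewrite exp_plus, <- Rmult_assoc, HN, exp_2tau by exact X0.
      apply Rmult_le_reg_r with (Cmod x * Cmod x); [nra|].
      rewrite Rmult_assoc, Rinv_l by nra.
      apply Rle_trans with (eps / (r * r) * (3 / 4 * r * (3 / 4 * r))).
      { replace (eps / (r * r) * (3 / 4 * r * (3 / 4 * r))) with (eps * (9 / 16)) by (field; lra).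
        lra. }
      apply Rmult_le_compat_l; [left; apply Rdiv_lt_0_compat; nra|nra]. }
  destruct (circle_max_spec u A a T0 t Hu ltac:(lra)) as [_ (z1 & Hz1 & E1 & Em)].
  fold m in Em.
  assert (Hr1 : Cmod z1 = r) by (unfold r; rewrite <- (exp_tau z1), <- (exp_tau z), E1; auto).
  specialize (Harnack w r eps Hz Heps Hw z1 z Hr1 eq_refl).
  assert (W1 : w z1 <= eps).
  { unfold w, B. rewrite E1, Em. specialize (Hl (t - 1) t ltac:(lra) ltac:(lra)). lra. }
  assert (W1' : 0 <= w z1) by (apply Hw; rewrite Hr1; lra).
  assert (K2 : K * (w z1 + eps) <= eta).
  { apply Rle_trans with (K * (eps + eps)); [apply Rmult_le_compat_l; lra|].
    right. unfold eps. field. lra. }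
  assert (m t - u z = w z - w z1).
  { unfold w. rewrite E1, Em. unfold t. ring. }
  lra.
Qed.

(** * Behaviour at the puncture *)

(** The harmonic function [tau] tends to infinity at the puncture, so subtracting
    [b * tau] with [b] arbitrarily small closes that end of the domain. *)
Lemma max_principle_puncture (f : C -> R) (t0 : R) :
  (forall z, 0 < Cmod z -> t0 <= tau z -> exists L, has_lap f z L /\
     (0 < f z -> t0 < tau z /\ 0 < L)) ->
  (forall b, 0 < b -> exists t1, forall z, 0 < Cmod z -> t1 <= tau z ->
     f z <= b * (tau z - t0)) ->
  forall z, 0 < Cmod z -> t0 <= tau z -> f z <= 0.
Proof.
  intros H Hg z Hz Hzt.
  assert (P : forall b, 0 < b -> f z <= b * (tau z - t0)).
  { intros b Hb. destruct (Hg b Hb) as [t1 Ht1].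
    set (t2 := Rmax t1 (tau z)).
    assert (Q : f z - (b * tau z + (- (b * t0))) <= 0); [|lra].
    apply (max_principle_tau t0 t2 (fun w => f w - (b * tau w + (- (b * t0))))).
    - intros w Hw [Hw1 Hw2]. destruct (H w Hw Hw1) as (L & HL & H').
      exists (L - (b * 0 + 0)). split.
      { apply has_lap_minus; [exact HL|].
        apply has_lap_plus; [apply has_lap_scal; now apply has_lap_tau|apply has_lap_const]. }
      intros Hpos. assert (0 <= b * (tau w - t0)) by (apply Rmult_le_pos; lra).
      destruct H' as [H1 H2]; [lra|]. split; [|lra]. split; [exact H1|].
      apply Rnot_le_lt. intros K. specialize (Ht1 w Hw).
      assert (t1 <= t2) by apply Rmax_l. specialize (Ht1 ltac:(lra)). lra.
    - exact Hz.
    - split; [exact Hzt|apply Rmax_r]. }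
  apply Rnot_lt_le. intros Hf.
  set (D := tau z - t0 + 1). assert (HD : 0 < D) by (unfold D; lra).
  specialize (P (f z / (2 * D)) ltac:(apply Rdiv_lt_0_compat; lra)).
  assert (f z / (2 * D) * (tau z - t0) <= f z / (2 * D) * D).
  { apply Rmult_le_compat_l; [left; apply Rdiv_lt_0_compat; lra|unfold D; lra]. }
  replace (f z / (2 * D) * D) with (f z / 2) in H0 by (field; lra). lra.
Qed.

Lemma circle_lower_bound (u : C -> R) (A a T0 t : R) :
  pinched u A a T0 -> T0 < t ->
  exists Q, forall z, 0 < Cmod z -> tau z = t -> - Q <= u z.
Proof.
  intros Hu Ht.
  destruct (compact_max (fun z => exp (- t) <= Cmod z <= exp (- t)) (exp (- t))
     (fun z => - u z)) as (z0 & _ & Hmax).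
  { intros z [_ Hz]. now apply Cmod_bounds. }
  { apply closed_annulus. }
  { exists (RtoC (exp (- t))). pose proof (exp_pos (- t)).
    rewrite Cmod_R, Rabs_pos_eq; lra. }
  { intros z Hz. destruct (annulus_tau _ _ _ Hz) as [Z1 Z2].
    destruct (Hu z Z1) as (L & HL & _); [lra|].
    apply (continuous_opp u). now apply has_lap_continuous with L. }
  exists (- u z0). intros z Hz Hzt.
  specialize (Hmax z (tau_annulus t t z Hz ltac:(lra))). lra.
Qed.

Lemma lower_growth (u : C -> R) (A a T0 alpha b : R) :
  0 < A -> 0 < a -> pinched u A a T0 -> 0 <= T0 ->
  asymptotic_slope T0 (circle_max u) alpha -> 0 < b ->
  exists t1, forall z, 0 < Cmod z -> t1 <= tau z -> (alpha - b) * tau z <= u z.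
Proof.
  intros HA Ha Hu HT S Hb.
  destruct (oscillation_vanishes u A a T0 alpha 1 HA Ha Hu S Rlt_0_1) as (t0 & Ht0 & Hosc).
  destruct (asymptotic_slope_limit _ _ _ (b / 2) S ltac:(lra)) as (t2 & Ht2 & Hlim).
  exists (Rmax (Rmax t0 t2) (2 / b) + 1).
  intros z Hz Ht.
  pose proof (Rmax_l (Rmax t0 t2) (2 / b)). pose proof (Rmax_r (Rmax t0 t2) (2 / b)).
  pose proof (Rmax_l t0 t2). pose proof (Rmax_r t0 t2).
  specialize (Hosc z Hz ltac:(lra)). specialize (Hlim (tau z) ltac:(lra)).
  set (t := tau z) in *. set (M := circle_max u t) in *.
  apply Rabs_lt_between in Hlim. destruct Hlim as [Hlim _].
  apply Rmult_lt_compat_r with (r := t) in Hlim; [|lra].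
  replace ((M / t - alpha) * t) with (M - alpha * t) in Hlim by (field; lra).
  assert (1 <= b / 2 * t).
  { replace 1 with (b / 2 * (2 / b)) by (field; lra). apply Rmult_le_compat_l; lra. }
  lra.
Qed.

(** Since [u <= alpha tau + C0], the Laplacian of [u] is at most [B e^(2 alpha tau)].
    When [alpha < 1] the function [c e^(- g tau)], [g = 2 - 2 alpha], is bounded and has
    a larger Laplacian, so adding it makes [alpha tau - u] subharmonic. *)
Lemma lower_bound_subcritical (u : C -> R) (A a T0 alpha : R) :
  0 < A -> 0 < a -> pinched u A a T0 -> 0 <= T0 ->
  asymptotic_slope T0 (circle_max u) alpha -> alpha < 1 ->
  exists Q, forall z, 0 < Cmod z -> T0 + 1 <= tau z -> alpha * tau z - Q <= u z.
Proof.
  intros HA Ha Hu HT S Hal.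
  set (t0 := T0 + 1).
  destruct (circle_lower_bound u A a T0 t0 Hu ltac:(unfold t0; lra)) as [Q HQ].
  set (C0 := circle_max u t0 - alpha * t0).
  set (B := a * exp (2 * C0)).
  assert (HB : 0 < B) by (apply Rmult_lt_0_compat; [exact Ha|apply exp_pos]).
  set (g := 2 - 2 * alpha). assert (Hg : 0 < g) by (unfold g; lra).
  set (c := (B + 1) / (g * g)).
  assert (Hc : 0 < c) by (apply Rdiv_lt_0_compat; nra).
  set (K := c + alpha * t0 + Q).
  set (phi := fun t => alpha * t + c * exp (- (g * t)) - K).
  set (psi := fun t => alpha - c * g * exp (- (g * t))).
  assert (Hexp : forall t, t0 <= t -> exp (- (g * t)) <= 1).
  { intros t Ht. rewrite <- exp_0. apply exp_le_iff.
    assert (0 <= g * t) by (apply Rmult_le_pos; unfold t0 in *; lra). lra. }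
  exists K. intros z Hz Hzt. fold t0 in Hzt.
  assert (Hf : phi (tau z) - u z <= 0).
  2: { unfold phi in Hf. pose proof (exp_pos (- (g * tau z))).
       assert (0 < c * exp (- (g * tau z))) by nra. lra. }
  apply (max_principle_puncture (fun w => phi (tau w) - u w) t0); [| |exact Hz|exact Hzt].
  - intros w Hw Hwt.
    destruct (Hu w Hw) as (L & HL & _ & B2); [unfold t0 in *; lra|].
    exists (c * (g * g) * exp (- (g * tau w)) * exp (2 * tau w) - L). split.
    { apply has_lap_minus; [|exact HL].
      apply (has_lap_radial phi psi _ 1 w Hw Rlt_0_1).
      - intros t _. unfold phi, psi. auto_derive; [exact I|]. ring.
      - unfold psi. auto_derive; [exact I|]. ring. }
    intros Hpos. split.
    + apply Rnot_le_lt. intros H. assert (E : tau w = t0) by lra.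
      specialize (HQ w Hw E). rewrite E in Hpos. unfold phi, K in Hpos.
      specialize (Hexp t0 (Rle_refl _)). nra.
    + assert (Huw : u w <= alpha * tau w + C0).
      { destruct (circle_max_spec u A a T0 (tau w) Hu ltac:(unfold t0 in *; lra)) as [Hm _].
        specialize (Hm w Hw eq_refl). destruct S as [S1 _].
        specialize (S1 t0 (tau w) ltac:(unfold t0; lra) Hwt). unfold C0. lra. }
      assert (L <= B * exp (2 * alpha * tau w)).
      { eapply Rle_trans; [exact B2|]. unfold B. rewrite Rmult_assoc, <- exp_plus.
        apply Rmult_le_compat_l; [lra|]. apply exp_le_iff. lra. }
      rewrite Rmult_assoc, <- exp_plus.
      replace (- (g * tau w) + 2 * tau w) with (2 * alpha * tau w) by (unfold g; ring).
      replace (c * (g * g)) with (B + 1) by (unfold c; field; lra).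
      pose proof (exp_pos (2 * alpha * tau w)). lra.
  - intros b Hb.
    destruct (lower_growth u A a T0 alpha (b / 2) HA Ha Hu HT S ltac:(lra)) as [t1 Ht1].
    exists (Rmax t0 (Rmax t1 (2 * (Rabs (c - K) + b * t0) / b))).
    intros w Hw Hwt.
    set (X := 2 * (Rabs (c - K) + b * t0) / b) in *.
    pose proof (Rmax_l t0 (Rmax t1 X)). pose proof (Rmax_r t0 (Rmax t1 X)).
    pose proof (Rmax_l t1 X). pose proof (Rmax_r t1 X).
    specialize (Ht1 w Hw ltac:(lra)). specialize (Hexp (tau w) ltac:(lra)).
    assert (HX : b / 2 * X = Rabs (c - K) + b * t0) by (unfold X; field; lra).
    assert (b / 2 * X <= b / 2 * tau w) by (apply Rmult_le_compat_l; lra).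
    pose proof (Rle_abs (c - K)).
    assert (c * exp (- (g * tau w)) <= c) by nra.
    unfold phi. lra.
Qed.

(** [t - ln t - K] is a subsolution of the equation with curvature [-a] once
    [a e^(- 2 K) <= 1], and it grows no faster than [u] up to [o (tau)], as the maximum
    principle at the puncture requires. *)
Lemma lower_bound_critical (u : C -> R) (A a T0 : R) :
  0 < A -> 0 < a -> pinched u A a T0 -> 0 <= T0 ->
  asymptotic_slope T0 (circle_max u) 1 ->
  exists K, forall z, 0 < Cmod z -> T0 + 1 <= tau z ->
    tau z - ln (tau z) - K <= u z.
Proof.
  intros HA Ha Hu HT S.
  set (t0 := T0 + 1).
  assert (Ht0 : 1 <= t0) by (unfold t0; lra).
  assert (Hln : forall t, t0 <= t -> 0 <= ln t).
  { intros t Ht. rewrite <- ln_1. apply ln_le; lra. }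
  destruct (circle_lower_bound u A a T0 t0 Hu ltac:(unfold t0; lra)) as [Q HQ].
  set (K := Rmax (ln a / 2) (t0 + Q)).
  assert (HK1 : ln a / 2 <= K) by apply Rmax_l.
  assert (HK2 : t0 + Q <= K) by apply Rmax_r.
  set (phi := fun t => t - ln t - K).
  set (psi := fun t => 1 - 1 / t).
  exists K. intros z Hz Hzt. fold t0 in Hzt.
  assert (Hf : phi (tau z) - u z <= 0); [|unfold phi in Hf; lra].
  apply (max_principle_puncture (fun w => phi (tau w) - u w) t0); [| |exact Hz|exact Hzt].
  - intros w Hw Hwt.
    destruct (Hu w Hw) as (L & HL & _ & B2); [unfold t0 in *; lra|].
    exists (1 / (tau w * tau w) * exp (2 * tau w) - L). split.
    { apply has_lap_minus; [|exact HL].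
      apply (has_lap_radial phi psi _ (tau w) w Hw ltac:(lra)).
      - intros t Ht. apply Rabs_lt_between in Ht. unfold phi, psi.
        auto_derive; [lra|]. field. lra.
      - unfold psi. auto_derive; [lra|]. field. lra. }
    intros Hpos. split.
    + apply Rnot_le_lt. intros H. assert (E : tau w = t0) by lra.
      specialize (HQ w Hw E). rewrite E in Hpos. unfold phi in Hpos.
      specialize (Hln t0 (Rle_refl _)). lra.
    + assert (E1 : a * exp (2 * u w) < a * exp (2 * phi (tau w))).
      { apply Rmult_lt_compat_l; [exact Ha|]. apply exp_increasing. lra. }
      assert (E2 : a * exp (2 * phi (tau w)) <= 1 / (tau w * tau w) * exp (2 * tau w)).
      { rewrite <- (exp_ln a) at 1 by exact Ha. rewrite <- exp_plus.
        replace (1 / (tau w * tau w)) with (exp (- (ln (tau w) + ln (tau w)))).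
        - rewrite <- exp_plus. apply exp_le_iff. unfold phi. lra.
        - rewrite exp_Ropp, exp_plus, exp_ln by lra. field. lra. }
      lra.
  - intros b Hb.
    destruct (lower_growth u A a T0 1 (b / 2) HA Ha Hu HT S ltac:(lra)) as [t1 Ht1].
    exists (Rmax t0 (Rmax t1 (2 * (Rabs K + b * t0) / b))).
    intros w Hw Hwt.
    set (X := 2 * (Rabs K + b * t0) / b) in *.
    pose proof (Rmax_l t0 (Rmax t1 X)). pose proof (Rmax_r t0 (Rmax t1 X)).
    pose proof (Rmax_l t1 X). pose proof (Rmax_r t1 X).
    specialize (Ht1 w Hw ltac:(lra)). specialize (Hln (tau w) ltac:(lra)).
    assert (HX : b / 2 * X = Rabs K + b * t0) by (unfold X; field; lra).
    assert (b / 2 * X <= b / 2 * tau w) by (apply Rmult_le_compat_l; lra).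
    pose proof (Rle_abs (- K)). rewrite Rabs_Ropp in *.
    unfold phi. lra.
Qed.

(** Along circles, [max u - alpha tau] decreases with [tau] and is bounded below, so it
    converges; the vanishing oscillation transfers the limit from the maxima to [u]. *)
Lemma subcritical_limit (u : C -> R) (A a T0 alpha : R) :
  0 < A -> 0 < a -> pinched u A a T0 -> 0 <= T0 ->
  asymptotic_slope T0 (circle_max u) alpha -> alpha < 1 ->
  exists l, forall eps, 0 < eps -> exists t1, forall z, 0 < Cmod z -> t1 < tau z ->
    Rabs (u z - alpha * tau z - l) <= eps.
Proof.
  intros HA Ha Hu HT S Hal.
  destruct (lower_bound_subcritical u A a T0 alpha HA Ha Hu HT S Hal) as [Q HQ].
  set (m := circle_max u) in *.
  set (E := fun y => exists t, T0 + 1 <= t /\ y = - (m t - alpha * t)).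
  destruct (completeness E) as [l [Hl1 Hl2]].
  { exists Q. intros y (t & Ht & ->).
    destruct (circle_max_spec u A a T0 t Hu ltac:(lra)) as [_ (z & Hz & Et & Em)].
    fold m in Em. specialize (HQ z Hz ltac:(lra)). rewrite Em, Et in HQ. lra. }
  { exists (- (m (T0 + 1) - alpha * (T0 + 1))), (T0 + 1). split; [lra|reflexivity]. }
  exists (- l). intros eps Heps.
  assert (HN : exists y, E y /\ l - eps < y).
  { apply NNPP. intros HN. assert (l <= l - eps); [|lra].
    apply Hl2. intros y Hy. apply Rnot_lt_le. intros H. apply HN. now exists y. }
  destruct HN as (y & (s & Hs & ->) & Hy).
  destruct (oscillation_vanishes u A a T0 alpha eps HA Ha Hu S Heps) as (t0 & Ht0 & Hosc).
  exists (Rmax s t0). intros z Hz Ht.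
  pose proof (Rmax_l s t0). pose proof (Rmax_r s t0).
  specialize (Hosc z Hz ltac:(lra)). fold m in Hosc.
  destruct (circle_max_spec u A a T0 (tau z) Hu ltac:(lra)) as [Hm _].
  specialize (Hm z Hz eq_refl). fold m in Hm.
  assert (G1 : - (m (tau z) - alpha * tau z) <= l).
  { apply Hl1. exists (tau z). split; [lra|reflexivity]. }
  destruct S as [S1 _]. specialize (S1 s (tau z) ltac:(lra) ltac:(lra)).
  apply Rabs_le_between. lra.
Qed.

(** * The order and the asymptotic expansion *)

Lemma critical_bounded (u : C -> R) (A a T0 : R) :
  0 < A -> 0 < a -> pinched u A a T0 -> 0 <= T0 ->
  asymptotic_slope T0 (circle_max u) 1 ->
  exists M t1, forall z, 0 < Cmod z -> t1 < tau z ->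
    Rabs (u z - tau z + ln (tau z)) <= M.
Proof.
  intros HA Ha Hu HT S.
  destruct (lower_bound_critical u A a T0 HA Ha Hu HT S) as [K HK].
  set (T1 := T0 + 1) in *.
  set (Cst := ln 2 - ln A / 2).
  exists (Rabs K + Rabs (Cst + ln 2)), (2 * T1). intros z Hz Ht.
  assert (HT1 : 1 <= T1) by (unfold T1; lra).
  specialize (HK z Hz ltac:(lra)).
  pose proof (ahlfors_bound u A a T0 T1 HA Hu ltac:(unfold T1; lra) z Hz ltac:(lra)) as Hup.
  fold Cst in Hup.
  assert (Hl : ln (tau z) - ln 2 <= ln (tau z - T1)).
  { rewrite <- ln_div by lra. apply ln_le; [apply Rdiv_lt_0_compat; lra|lra]. }
  pose proof (Rle_abs (Cst + ln 2)). pose proof (Rle_abs K).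
  pose proof (Rabs_pos (Cst + ln 2)). pose proof (Rabs_pos K).
  apply Rabs_le_between. lra.
Qed.

Lemma locally'_0_tau (P : C -> Prop) (t : R) :
  (forall z, 0 < Cmod z -> t < tau z -> P z) -> locally' (RtoC 0) P.
Proof.
  intros H.
  pose proof (continuous_Cmod (RtoC 0) (fun x => x < exp (- t))) as HC.
  rewrite Cmod_0 in HC. specialize (HC (open_lt (exp (- t)) 0 (exp_pos _))).
  unfold locally', within. revert HC. apply (filter_imp (fun z => Cmod z < exp (- t))).
  intros z Hz Hz0.
  assert (0 < Cmod z) by (now apply Cmod_gt_0).
  apply H; [assumption|]. now apply tau_lt_iff.
Qed.

Lemma locally'_0_exists_tau (P : C -> Prop) :
  locally' (RtoC 0) P ->
  exists t, 0 <= t /\ forall z, 0 < Cmod z -> t < tau z -> P z.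
Proof.
  intros H. apply locally_box in H. destruct H as [d [Hd H]].
  exists (Rmax 0 (- ln d)). split; [apply Rmax_l|].
  intros z Hz Ht. pose proof (Rmax_r 0 (- ln d)).
  assert (Hzd : Cmod z < d).
  { rewrite <- (exp_ln d Hd), <- (Ropp_involutive (ln d)). apply tau_lt_iff; [exact Hz|lra]. }
  destruct (Cmod_bounds z _ (Rle_refl _)).
  rewrite <- (C_eta z). apply H; cbn; try (rewrite Rminus_0_r; lra).
  rewrite C_eta. now apply Cmod_gt_0.
Qed.

Lemma punctured_disk_open z : punctured_disk z -> locally z punctured_disk.
Proof.
  intros [H1 H2]. apply Cmod_gt_0 in H1.
  pose proof (continuous_Cmod z (fun x => 0 < x) (open_gt 0 _ H1)) as A.
  pose proof (continuous_Cmod z (fun x => x < 1) (open_lt 1 _ H2)) as B.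
  generalize (filter_and (fun w => 0 < Cmod w) (fun w => Cmod w < 1) A B).
  apply filter_imp. intros w [W1 W2]. split; [now apply Cmod_gt_0|exact W2].
Qed.

Lemma pinched_of_equation (kappa u : C -> R) :
  strictly_negative_at_0 kappa -> C2_on punctured_disk u ->
  (forall z, punctured_disk z -> laplacian u z = - kappa z * exp (2 * u z)) ->
  exists A a T0, 0 < A /\ 0 < a /\ 0 <= T0 /\ pinched u A a T0.
Proof.
  intros (a & A & Ha & HA & Hk) Hu Heq.
  destruct (locally'_0_exists_tau _ Hk) as (T0 & HT & H).
  exists A, a, T0. repeat split; try assumption.
  intros z Hz Ht.
  assert (Hp : punctured_disk z).
  { split; [now apply Cmod_gt_0|]. rewrite <- exp_0, <- Ropp_0.
    apply tau_lt_iff; [exact Hz|lra]. }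
  exists (laplacian u z). split; [now apply (C2_has_lap punctured_disk); [|apply punctured_disk_open]|].
  rewrite Heq by exact Hp. specialize (H z Hz Ht). pose proof (exp_pos (2 * u z)).
  split; apply Rmult_le_compat_r; lra.
Qed.

Lemma asymptotic_slope_is_order (u : C -> R) T0 alpha :
  asymptotic_slope T0 (circle_max u) alpha -> is_order u alpha.
Proof.
  intros S. apply filterlim_locally. intros eps.
  destruct (asymptotic_slope_limit _ _ _ eps S (cond_pos eps)) as (t0 & Ht0 & H).
  exists (mkposreal _ (exp_pos (- t0))). intros r Hr Hr0.
  change (Rabs (r - 0) < exp (- t0)) in Hr. rewrite Rminus_0_r, Rabs_pos_eq in Hr by lra.
  change (Rabs (circle_sup u r / ln (1 / r) - alpha) < eps).
  replace (ln (1 / r)) with (- ln r) by (unfold Rdiv; rewrite Rmult_1_l, ln_Rinv; lra).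
  assert (Hl : t0 < - ln r).
  { apply ln_increasing in Hr; [|exact Hr0]. rewrite ln_exp in Hr. lra. }
  specialize (H (- ln r) Hl). unfold circle_max in H.
  now rewrite Ropp_involutive, exp_ln in H.
Qed.

Theorem theorem3p1 (kappa u : C -> R)
  (hkappa : strictly_negative_at_0 kappa)
  (hu : C2_on punctured_disk u)
  (heq : forall z : C, punctured_disk z ->
           laplacian u z = - kappa z * exp (2 * u z)) :
  exists alpha : R,
    is_order u alpha /\
    alpha <= 1 /\
    (alpha < 1 ->
       exists v : C -> R,
         (forall z : C, punctured_disk z ->
            u z = - alpha * ln (Cmod z) + v z) /\
         continuous v (RtoC 0)) /\
    (alpha = 1 ->
       exists w : C -> R,
         (forall z : C, punctured_disk z ->
            u z = - ln (Cmod z) - ln (ln (1 / Cmod z)) + w z) /\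
         bounded_near_0 w).
Proof.
  destruct (pinched_of_equation kappa u hkappa hu heq) as (A & a & T0 & HA & Ha & HT & Hp).
  clear hkappa hu heq.
  (* starting at [T0 + 2] makes the logarithm in [ahlfors_bound] nonnegative *)
  set (Cst := ln 2 - ln A / 2).
  destruct (convex_slope (T0 + 2) Cst (circle_max u)) as (alpha & Hal & S).
  { intros t1 t t2 H1. apply (circle_max_convex u A a T0 HA Hp). lra. }
  { intros t Ht.
    destruct (circle_max_spec u A a T0 t Hp ltac:(lra)) as [_ (z & Hz & E & <-)].
    pose proof (ahlfors_bound u A a T0 (T0 + 1) HA Hp ltac:(lra) z Hz ltac:(lra)) as H.
    fold Cst in H. rewrite E in H.
    assert (0 <= ln (t - (T0 + 1))) by (rewrite <- ln_1; apply ln_le; lra). lra. }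
  assert (Hp' : pinched u A a (T0 + 2)) by (intros z Hz Ht; apply Hp; lra).
  assert (HT' : 0 <= T0 + 2) by lra.
  exists alpha. split; [now apply asymptotic_slope_is_order with (T0 + 2)|].
  split; [exact Hal|]. split.
  - intros Hlt.
    destruct (subcritical_limit u A a _ alpha HA Ha Hp' HT' S Hlt) as [l Hl].
    exists (fun z => if Ceq_dec z (RtoC 0) then l else u z + alpha * ln (Cmod z)).
    split.
    + intros z [Hz _]. destruct (Ceq_dec z (RtoC 0)); [contradiction|]. ring.
    + apply filterlim_locally. intros eps.
      destruct (Ceq_dec (RtoC 0) (RtoC 0)) as [_|K]; [|now destruct K].
      destruct (Hl (eps / 2)) as [t1 Ht1]; [pose proof (cond_pos eps); lra|].
      assert (HL : locally' (RtoC 0) (fun z => Rabs (u z - alpha * tau z - l) <= eps / 2))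
        by (now apply locally'_0_tau with t1).
      unfold locally', within in HL. revert HL. apply filter_imp. intros z Hz.
      destruct (Ceq_dec z (RtoC 0)) as [E|E].
      * apply ball_center.
      * change (Rabs (u z + alpha * ln (Cmod z) - l) < eps).
        specialize (Hz E). unfold tau in Hz.
        replace (u z + alpha * ln (Cmod z) - l) with (u z - alpha * - ln (Cmod z) - l) by ring.
        pose proof (cond_pos eps). lra.
  - intros ->.
    destruct (critical_bounded u A a _ HA Ha Hp' HT' S) as (M & t1 & HM).
    exists (fun z => u z + ln (Cmod z) + ln (ln (1 / Cmod z))). split.
    + intros z _. ring.
    + exists M. apply locally'_0_tau with t1. intros z Hz Ht.
      specialize (HM z Hz Ht). unfold tau in HM.
      replace (ln (1 / Cmod z)) with (- ln (Cmod z))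
        by (unfold Rdiv; rewrite Rmult_1_l, ln_Rinv; lra).
      replace (u z + ln (Cmod z) + ln (- ln (Cmod z)))
        with (u z - - ln (Cmod z) + ln (- ln (Cmod z))) by ring. exact HM.
Qed.
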